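(* Let $S$ be a normalized symmetric set of integers containing $0$. Then: (1) If the total gap of $S$ is $3$ or more, then $\Sigma_S$ is disconnected. (2) If the total gap of $S$ is $1$ or $2$ and if $M = \max(S) \geqslant 40$, then $\Sigma_S$ is connected and locally connected.
   Context: $\mathbb{D}$ is the open unit disc in $\mathbb{C}$. For a non-empty bounded set $S$ of complex numbers, $\Sigma_S = \{ z \in \mathbb{D} \mid \exists\, p_0, p_1, \ldots \in S,\ p_0 \neq 0,\ \sum_{j=0}^\infty p_j z^j = 0 \}$, with the subspace topology from $\mathbb{C}$. A set $S$ is symmetric if $S = -S$. A set $S$ of real numbers is normalized if it is finite and non-empty, $1 \in S$, and $|s| \geqslant 1$ for every $s \in S$ with $s \neq 0$. For a normalized set $S = \{s_1 < s_2 < \cdots < s_n\}$, the total gap of $S$ is $\max_j |s_{j+1} - s_j|$. *)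

(* Defs.v *)
From HB Require Import structures.
From mathcomp Require Import all_boot all_order all_algebra finmap.
From mathcomp Require Import complex.
From mathcomp Require Import all_classical all_reals all_analysis.

Set Implicit Arguments.
Unset Strict Implicit.
Unset Printing Implicit Defensive.

Import Order.TTheory GRing.Theory Num.Theory.
Import numFieldNormedType.Exports.

Local Open Scope classical_set_scope.
Local Open Scope ring_scope.

(* The usual topology of the complex plane: the one that every numFieldType
   gets from its norm, made canonical on R[i] (the library declares it only
   on the regular module R[i]^o). *)
HB.instance Definition _ (R : realType) := NormedModule.copy R[i] R[i]^o.

(* Since the order of R[i] compares only numbers with the same imaginary part,
   `|z| < 1 holds exactly when the modulus of z is less than 1. *)
Definition unit_disc (R : realType) : set R[i] := [set z | `|z| < 1].

Definition Sigma (R : realType) (S : set R[i]) : set R[i] :=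
  [set z | unit_disc z /\
     exists p : nat -> R[i], [/\ forall j, S (p j), p 0%N != 0 &
       series (fun j => p j * z ^+ j) @ \oo --> (0 : R[i])]].

Definition set_of_reals (R : realType) (S : {fset R}) : set R[i] :=
  [set real_complex R s | s in [set` S]].

Definition symmetric_fset (R : realType) (S : {fset R}) : Prop :=
  S = [fset - s | s in S]%fset.

(* Finiteness is part of the type of S. *)
Definition normalized (R : realType) (S : {fset R}) : Prop :=
  [/\ S != fset0, 1 \in S & forall s, s \in S -> s != 0 -> 1 <= `|s|].

(* The sequence s enumerates S as s_1 < ... < s_n; the default value 0 of the
   maximum is harmless because every gap is nonnegative. *)
Definition total_gap (R : realType) (S : {fset R}) : R :=
  let s := sort <=%O (enum_fset S) in
  \big[Num.max/0]_(j < (size s).-1) `|s`_j.+1 - s`_j|.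

(* Local connectedness of A in the subspace topology: the open neighbourhoods
   of x in A are the traces on A of the open neighbourhoods of x in T, and each
   must contain a connected one. *)
Definition locally_connected (T : topologicalType) (A : set T) : Prop :=
  forall (x : T) (U : set T), A x -> open U -> U x ->
    exists V : set T,
      [/\ open V, V x, A `&` V `<=` A `&` U & connected (A `&` V)].

(* Main.v *)
Require Import Defs.
From HB Require Import structures.
From mathcomp Require Import all_boot all_order all_algebra finmap.
From mathcomp Require Import complex ring lra.
From mathcomp Require Import all_classical all_reals all_analysis.

Set Implicit Arguments.
Unset Strict Implicit.
Unset Printing Implicit Defensive.

Import Order.TTheory GRing.Theory Num.Theory.
Import numFieldNormedType.Exports.
Import Normc.

Local Open Scope classical_set_scope.
Local Open Scope ring_scope.

(** Write [beta = 1 / z]. A point [z] of the open disc other than 0 is a root of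
a bounded series [f] exactly when the coefficients of [f / (1 - beta X)] are
bounded, and they are then at most [M / (|beta| - 1)], where [M] bounds the
coefficients of [f]. Dividing by several roots in turn gives
[|f_0| <= M / ((|beta_1| - 1) .. (|beta_k| - 1))]: few roots fit near the
origin, and a nonreal root, which comes with its conjugate, counts twice.

Large gap. For [beta] slightly below [M + 1] a root on the circle of radius
[1 / beta] must therefore be real, and by symmetry it may be taken positive.
The remainders of the corresponding expansion of 1 in base [beta] are forced,
with digits [M], to follow the orbit of 1 under [t |-> beta t - M]; an
intermediate value argument chooses [beta] so that [beta t] reaches the middle
of a gap of length at least 3, where every digit leaves too large a remainder.
So Sigma avoids this circle ([Sigma_misses_circle]), although it contains
[1 / (M + 1)] inside it and 1/2 outside.

Small gaps. Let [r = 1 / (sqrt (M + 2) - 1)]. A greedy expansion, for which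
gaps at most 2 are just small enough, shows that Sigma contains the annulus
[r <= |z| < 1] and the real points with [1 / (M + 1) <= |z| < 1]; call their
union the skeleton. For [M >= 40] the bound above says that a nonreal root with
[|z| < r] is the only one of its series in the upper half disc of radius [r],
up to normalization has [f_0 = 1], and, being simple, moves continuously with
[f] ([root_separation], [root_perturb]).

Fix a word [w] starting with 1 and consider the series that start with [w].
Multiplying a polynomial by [1 / (1 - t X^n)], with [t] in {-1, 0, 1}, does not
change its roots near the origin, but shifts its coefficient of index [n] by
[t]. Hence two letters at distance at most 2 can follow [w] in two series with
the same roots ([letter_change], an idea of Bousch). If now [K] is a clopen part
of the nonreal roots of the series starting with [w], having a root in [K] is a
locally constant property of the series, and it does not depend on the next
letter; so it is constant ([clopen_roots_all]). In particular [K] is empty if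
one of these series has no root in [K]. For [w = 1] the series 1 shows that
every clopen part of Sigma meets the skeleton, which is connected. For a long
word [w], the roots form a set of small diameter, and the same argument joins
each of them, inside a small ball, to any given point of Sigma that they
approach; this is local connectedness. *)

(** * The modulus of a complex number, and geometric growth *)

Section Modulus.
Local Open Scope complex_scope.
Variable R : realType.
Implicit Types (x y z : R[i]) (a r : R).

Lemma normc_leD x y : normc (x + y) <= normc x + normc y.
Proof. exact: (@le_normcD R). Qed.

Lemma normc_opp x : normc (- x) = normc x.
Proof. exact: (@normcN R). Qed.

Lemma normc_ge0 x : 0 <= normc x.
Proof. by case: x => a b /=; apply: sqrtr_ge0. Qed.

Lemma normc_eq0 x : (normc x == 0) = (x == 0).
Proof. by apply/eqP/eqP => [/eq0_normc|->] //; rewrite normc0. Qed.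

Lemma normc_gt0 x : (0 < normc x) = (x != 0).
Proof. by rewrite lt0r normc_ge0 andbT normc_eq0. Qed.

Lemma normcX x n : normc (x ^+ n) = normc x ^+ n.
Proof. by elim: n => [|n IH]; rewrite ?normc1 // !exprS normcM IH. Qed.

Lemma normc_real a : normc (a%:C) = `|a|.
Proof. by rewrite /normc /= expr0n /= addr0 sqrtr_sqr. Qed.

Lemma normc_conj x : normc (x^*) = normc x.
Proof. by case: x => a b /=; rewrite sqrrN. Qed.

Lemma normcBC x y : normc (x - y) = normc (y - x).
Proof. by rewrite -opprB normc_opp. Qed.

Lemma normcB_triangle y x z : normc (x - z) <= normc (x - y) + normc (y - z).
Proof. by apply: le_trans (normc_leD _ _); rewrite addrA subrK. Qed.

Lemma normcB_ge x y : normc x - normc y <= normc (x - y).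
Proof. by rewrite lerBlDr; apply: le_trans (normc_leD _ _); rewrite subrK. Qed.

Lemma normcB_le x y : normc (x - y) <= normc x + normc y.
Proof. by apply: le_trans (normc_leD _ _) _; rewrite normc_opp. Qed.

Lemma normc_sum n (F : nat -> R[i]) :
  normc (\sum_(i < n) F i) <= \sum_(i < n) normc (F i).
Proof.
elim: n => [|n IH]; first by rewrite !big_ord0 normc0.
by rewrite !big_ord_recr /=; apply: le_trans (normc_leD _ _) _; rewrite lerD2r.
Qed.

Lemma sqr_normcE x : normc x ^+ 2 = complex.Re x ^+ 2 + complex.Im x ^+ 2.
Proof. by case: x => a b /=; rewrite sqr_sqrtr // addr_ge0 ?sqr_ge0. Qed.

Lemma normc_Re_le x : `|complex.Re x| <= normc x.
Proof.
rewrite -(@ler_pXn2r _ 2) ?nnegrE ?normc_ge0 // sqr_normcE real_normK ?num_real //.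
by rewrite lerDl sqr_ge0.
Qed.

Lemma normc_Im_le x : `|complex.Im x| <= normc x.
Proof.
rewrite -(@ler_pXn2r _ 2) ?nnegrE ?normc_ge0 // sqr_normcE real_normK ?num_real //.
by rewrite lerDr sqr_ge0.
Qed.

Lemma normc_ReIm_le x : normc x <= `|complex.Re x| + `|complex.Im x|.
Proof.
rewrite -(@ler_pXn2r _ 2) ?nnegrE ?normc_ge0 ?addr_ge0 // sqr_normcE.
rewrite -(real_normK (num_real (complex.Re x))) -(real_normK (num_real (complex.Im x))).
have := normr_ge0 (complex.Re x); have := normr_ge0 (complex.Im x); nra.
Qed.

Lemma sum_geometric_le r n : 0 <= r -> r < 1 ->
  \sum_(i < n) r ^+ i <= (1 - r)^-1.
Proof.
move=> r0 r1; have h : 0 < 1 - r by rewrite subr_gt0.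
have e : (1 - r) * (\sum_(i < n) r ^+ i) = 1 - r ^+ n.
  by rewrite -[1 - r]opprB mulNr -subrX1 opprB.
rewrite -(ler_pM2l h) e mulfV ?lt0r_neq0 //.
by rewrite gerBl exprn_ge0.
Qed.

Lemma exprn_large a (x : R) : 1 < a -> exists n, x < a ^+ n.
Proof.
move=> a1; have h : 0 < a - 1 by rewrite subr_gt0.
have bernoulli n : 1 + n%:R * (a - 1) <= a ^+ n.
  elim: n => [|n IH]; first by rewrite mul0r addr0 expr0.
  rewrite exprS -natr1; have n0 : 0 <= n%:R :> R by rewrite ler0n.
  have a0 : 0 <= a by lra.
  have nh : 0 <= n%:R * (a - 1) * (a - 1) by rewrite !mulr_ge0 // ltW.
  by apply: le_trans (ler_wpM2l a0 IH); lra.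
have [x0|x0] := leP 0 x; last by exists 0%N; rewrite expr0 (lt_trans x0).
exists (Num.bound (x / (a - 1))).
have := archi_boundP (divr_ge0 x0 (ltW h)); rewrite ltr_pdivrMr // => hb.
by apply: lt_le_trans (bernoulli _); rewrite (lt_trans hb) // ltrDr.
Qed.

Lemma exprn_small r (e : R) : 0 <= r -> r < 1 -> 0 < e -> exists n, r ^+ n < e.
Proof.
move=> r0 r1 e0; have [->|rn0] := eqVneq r 0; first by exists 1%N; rewrite expr1.
have rp : 0 < r by rewrite lt0r rn0.
have [n hn] := @exprn_large r^-1 e^-1 (eqbRL (invf_gt1 rp) r1).
exists n; rewrite -(ltf_pV2 (x := e)) ?posrE ?exprn_gt0 // -exprVn //.
Qed.

Lemma le0_of_geometric r (K x : R) N : 0 <= r -> r < 1 ->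
  (forall n, (N <= n)%N -> x <= K * r ^+ n) -> x <= 0.
Proof.
move=> r0 r1 h; rewrite leNgt; apply/negP => x0.
have K0 : 0 < K.
  have := lt_le_trans x0 (h N (leqnn _)); have := exprn_ge0 N r0 => p q.
  by rewrite ltNge; apply/negP => K0; move: q; rewrite ltNge mulr_le0_ge0.
have [n hn] := exprn_small r0 r1 (divr_gt0 x0 K0).
have := h (N + n)%N (leq_addr _ _); apply/negP; rewrite -ltNge.
rewrite mulrC -ltr_pdivlMr // (le_lt_trans _ hn) // exprD.
by rewrite ler_piMl ?exprn_ge0 // exprn_ile1 // ltW.
Qed.

Lemma le_of_geometric r (K x y : R) N : 0 <= r -> r < 1 ->
  (forall n, (N <= n)%N -> x <= y + K * r ^+ n) -> x <= y.
Proof.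
move=> r0 r1 h; rewrite -subr_le0; apply: (le0_of_geometric (K := K) (N := N)) r0 r1 _.
by move=> n /h; rewrite lerBlDl.
Qed.

End Modulus.

(** * Dividing a power series by a linear factor *)

Section Division.
Local Open Scope complex_scope.
Variable R : realType.
Implicit Types (b x z : R[i]) (u v : nat -> R[i]) (n m : nat).

(** Coefficients of the formal quotient of [u] by [1 - b X]. *)
Fixpoint divlin b u n : R[i] :=
  if n is m.+1 then b * divlin b u m + u m.+1 else u 0%N.

Definition psum u n z : R[i] := \sum_(i < n) u i * z ^+ i.

Definition bseq u := exists B : R, forall n, normc (u n) <= B.

(** For a bounded [u] and [|z| < 1], bounded coefficients of [u / (1 - X / z)]
mean that the series vanishes at [z]: see [series_root_psum] and
[series_root_of_psum]. In this form several roots can be divided out in turn. *)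
Definition series_root u z := z != 0 /\ bseq (divlin z^-1 u).

Lemma divlin_ext b u v n :
  (forall i, (i <= n)%N -> u i = v i) -> divlin b u n = divlin b v n.
Proof.
elim: n => [|n IH] h /=; first exact: h.
by rewrite h // IH // => i hi; apply: h; apply: leqW.
Qed.

Lemma psum_ext u v n z :
  (forall i, (i < n)%N -> u i = v i) -> psum u n z = psum v n z.
Proof. by move=> h; apply: eq_bigr => i _; rewrite h. Qed.

Lemma divlinN b u n : divlin b (fun i => - u i) n = - divlin b u n.
Proof. by elim: n => [|n /= ->] //; rewrite mulrN opprD. Qed.

Lemma divlin_conj b u n : (forall i, (u i)^* = u i) ->
  divlin b^* u n = (divlin b u n)^*.
Proof.
move=> h; elim: n => [|n IH] /=; first by rewrite h.
by rewrite IH -[in LHS](h n.+1) rmorphD rmorphM.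
Qed.

(** An excess of [divlin b u] over the claimed bound would be multiplied by at
least [|b|] at each step, so a bounded quotient has none. *)
Lemma divlin_le b u (t : R) : 1 < normc b -> (forall n, normc (u n) <= t) ->
  bseq (divlin b u) -> forall n, normc (divlin b u n) <= t / (normc b - 1).
Proof.
move=> b1 ut [B hB] n; set a := normc b in b1 *; set s := t / (a - 1).
have a0 : 0 < a - 1 by rewrite subr_gt0.
have ts : t = s * (a - 1) by rewrite /s divfK ?lt0r_neq0.
have step m : (normc (divlin b u m) - s) * a <= normc (divlin b u m.+1) - s.
  have := normcB_ge (b * divlin b u m) (- u m.+1).
  rewrite normcM normc_opp opprK -/a => h; have := ut m.+1.
  have -> : divlin b u m.+1 = b * divlin b u m + u m.+1 by [].
  by rewrite ts; nra.
have grow k : (normc (divlin b u n) - s) * a ^+ k <= normc (divlin b u (n + k)) - s.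
  elim: k => [|k IH]; first by rewrite expr0 mulr1 addn0.
  rewrite addnS exprSr mulrA; apply: le_trans (step _).
  by rewrite ler_wpM2r // ltW // (lt_trans _ b1).
rewrite -subr_le0 leNgt; apply/negP => x0.
have [k hk] := exprn_large ((B - s) / (normc (divlin b u n) - s)) b1.
move: hk; rewrite ltr_pdivrMr // mulrC => hk.
by have := grow k; have := hB (n + k)%N; lra.
Qed.

(** Partial fractions for [1 / ((1 - b X) (1 - c X))]. *)
Lemma divlin_divlin b c u n : b != c ->
  divlin c (divlin b u) n = (b * divlin b u n - c * divlin c u n) / (b - c).
Proof.
move=> bc; have h : b - c != 0 by rewrite subr_eq0.
elim: n => [|n IH] /=; first by field.
by rewrite IH; field.
Qed.

Lemma bseq_divlin2 b c u : b != c -> bseq (divlin b u) -> bseq (divlin c u) ->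
  bseq (divlin c (divlin b u)).
Proof.
move=> bc [B hB] [C hC].
exists ((normc b * B + normc c * C) / normc (b - c)) => n.
rewrite divlin_divlin // normcM normcV ler_wpM2r ?invr_ge0 ?normc_ge0 //.
apply: le_trans (normcB_le _ _) _; rewrite !normcM.
by rewrite lerD // ler_wpM2l ?normc_ge0.
Qed.

Lemma psumS u n z : psum u n.+1 z = psum u n z + u n * z ^+ n.
Proof. by rewrite /psum big_ord_recr. Qed.

Lemma psum_divlin b u n x :
  psum u n.+1 x = (1 - b * x) * psum (divlin b u) n.+1 x + b * x ^+ n.+1 * divlin b u n.
Proof.
elim: n => [|n IH]; first by rewrite /psum !big_ord1 /= !expr0 expr1; ring.
by rewrite psumS IH [psum _ n.+2 _]psumS /= !exprS; ring.
Qed.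

Lemma psum_divlin_root u n z : z != 0 -> psum u n.+1 z = z ^+ n * divlin z^-1 u n.
Proof.
move=> z0; rewrite (psum_divlin z^-1) mulVf // subrr mul0r add0r exprS.
by rewrite mulrA mulVf // mul1r.
Qed.

Lemma psum_tail u (M : R) z n m : (forall i, normc (u i) <= M) -> normc z < 1 ->
  (n <= m)%N ->
  normc (psum u m z - psum u n z) <= M * normc z ^+ n / (1 - normc z).
Proof.
move=> uM z1 /subnK <-; set k := (m - n)%N; set r := normc z.
have r0 : 0 <= r := normc_ge0 z.
have M0 : 0 <= M := le_trans (normc_ge0 _) (uM 0%N).
have h : psum u (k + n) z - psum u n z = \sum_(i < k) u (i + n)%N * z ^+ (i + n).
  elim: k => [|k IH]; first by rewrite add0n subrr big_ord0.
  by rewrite addSn psumS big_ord_recr /= -IH; ring.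
rewrite h; apply: le_trans (normc_sum _ (fun i => u (i + n)%N * z ^+ (i + n))) _.
apply: (@le_trans _ _ (M * r ^+ n * \sum_(i < k) r ^+ i)).
  rewrite mulr_sumr; apply: ler_sum => i _.
  rewrite normcM normcX -/r -mulrA -exprD addnC.
  by rewrite ler_wpM2r ?exprn_ge0.
by rewrite ler_wpM2l ?mulr_ge0 ?exprn_ge0 // sum_geometric_le.
Qed.

Lemma series_root_psum u (M : R) z : (forall i, normc (u i) <= M) ->
  normc z < 1 -> series_root u z ->
  forall n, normc (psum u n.+1 z) <= M * normc z ^+ n.+1 / (1 - normc z).
Proof.
move=> uM z1 [z0 rz] n; set r := normc z in z1 *.
have r0 : 0 < r by rewrite normc_gt0.
have h : 1 < normc z^-1 by rewrite normcV invf_gt1.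
have := divlin_le h uM rz n; rewrite normcV -/r => hd.
rewrite psum_divlin_root // normcM normcX -/r.
have -> : M * r ^+ n.+1 / (1 - r) = r ^+ n * (M / (r^-1 - 1)).
  by rewrite exprS; field; rewrite !lt0r_neq0 //; lra.
by rewrite ler_wpM2l ?exprn_ge0 // ltW.
Qed.

Lemma series_root_of_psum u (M : R) z : (forall i, normc (u i) <= M) ->
  z != 0 -> normc z < 1 ->
  (forall e : R, 0 < e -> forall N, exists2 m, (N <= m)%N & normc (psum u m z) < e) ->
  series_root u z.
Proof.
move=> uM z0 z1 hl; set r := normc z in z1 *.
have r0 : 0 < r by rewrite normc_gt0.
split=> //; exists (M * r / (1 - r)) => n.
rewrite -(ler_pM2l (exprn_gt0 n r0)) -normcX -normcM -psum_divlin_root //.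
have -> : normc (z ^+ n) * (M * r / (1 - r)) = M * r ^+ n.+1 / (1 - r).
  by rewrite normcX -/r exprS; ring.
apply/ler_addgt0Pr => e e0; have [m nm hm] := hl e e0 n.+1.
have := psum_tail uM z1 nm; have := normcB_triangle (psum u m z) (psum u n.+1 z) 0.
by rewrite !subr0 [normc (psum u n.+1 z - _)]normcBC -/r; lra.
Qed.
End Division.

(** * Roots of real power series near the origin *)

Section Roots.
Local Open Scope complex_scope.
Variable R : realType.
Implicit Types (x z : R[i]) (f g : nat -> R) (M r : R) (n : nat).

Definition cseq f : nat -> R[i] := fun i => (f i)%:C.

Definition root_of f z := series_root (cseq f) z.

Lemma cseq_bound f M i : `|f i| <= M -> normc (cseq f i) <= M.
Proof. by rewrite normc_real. Qed.

Lemma nonreal_neq_conj z : complex.Im z != 0 -> z != z^*.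
Proof.
case: z => a b /=; apply: contra => /eqP [] h.
by apply/eqP; lra.
Qed.

Lemma root_conj f z : root_of f z -> root_of f z^*.
Proof.
move=> [z0 [B hB]]; split; first by rewrite conjc_eq0.
exists B => n; rewrite -conjc_inv divlin_conj ?normc_conj // => i.
by rewrite /cseq conjc_real.
Qed.

Lemma rootN f z : root_of f z -> root_of (fun i => - f i) z.
Proof.
move=> [z0 [B hB]]; split=> //; exists B => n.
have -> : divlin z^-1 (cseq (fun i => - f i)) n = - divlin z^-1 (cseq f) n.
  by rewrite -divlinN; apply: divlin_ext => i _; rewrite /cseq rmorphN.
by rewrite normc_opp.
Qed.

Lemma inv_bound z r M : 0 < r -> r < 1 -> z != 0 -> normc z <= r -> 0 <= M ->
  1 < normc z^-1 /\ M / (normc z^-1 - 1) <= M * r / (1 - r).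
Proof.
move=> r0 r1 z0 zr M0; have n0 : 0 < normc z by rewrite normc_gt0.
have h : r^-1 <= normc z^-1 by rewrite normcV lef_pV2.
have hr : 1 < r^-1 by rewrite invf_gt1.
split; first exact: lt_le_trans h.
have -> : M * r / (1 - r) = M / (r^-1 - 1).
  by field; rewrite !lt0r_neq0 //; lra.
rewrite ler_wpM2l // lef_pV2 ?posrE; lra.
Qed.

Lemma root_quotient_le f M r z : (forall i, `|f i| <= M) -> 0 < r -> r < 1 ->
  normc z <= r -> root_of f z ->
  forall n, normc (divlin z^-1 (cseq f) n) <= M * r / (1 - r).
Proof.
move=> fM r0 r1 zr [z0 rz] n; have M0 : 0 <= M := le_trans (normr_ge0 _) (fM 0%N).
have [h1 h2] := inv_bound r0 r1 z0 zr M0.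
by apply: le_trans (divlin_le h1 _ rz n) h2 => i; apply: cseq_bound.
Qed.

Definition quad_quotient f z := divlin (z^*)^-1 (divlin z^-1 (cseq f)).

(** A nonreal root comes with its conjugate, so both linear factors can be
divided out, each costing a factor [r / (1 - r)]. *)
Lemma quad_quotient_le f M r z : (forall i, `|f i| <= M) -> 0 < r -> r < 1 ->
  normc z <= r -> complex.Im z != 0 -> root_of f z ->
  forall n, normc (quad_quotient f z n) <= M * r ^+ 2 / (1 - r) ^+ 2.
Proof.
move=> fM r0 r1 zr zi rz n; have M0 : 0 <= M := le_trans (normr_ge0 _) (fM 0%N).
have [z0 [zc0 bc]] := (rz.1, root_conj rz).
have zcr : normc z^* <= r by rewrite normc_conj.
have M1 : 0 <= M * r / (1 - r) by apply: divr_ge0; [apply: mulr_ge0 => //; exact: ltW | lra].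
have [h1 h2] := inv_bound r0 r1 zc0 zcr M1.
have bq : bseq (divlin (z^*)^-1 (divlin z^-1 (cseq f))).
  apply: bseq_divlin2 rz.2 bc.
  by rewrite (inj_eq invr_inj) nonreal_neq_conj.
apply: le_trans (divlin_le h1 (root_quotient_le fM r0 r1 zr rz) bq n) _.
apply: (le_trans h2); rewrite le_eqVlt; apply/orP; left; apply/eqP.
by field; apply: lt0r_neq0; lra.
Qed.

(** A nonreal root counts twice: compare [root_lead]. *)
Lemma nonreal_root_lead f M r z : (forall i, `|f i| <= M) -> 0 < r -> r < 1 ->
  normc z <= r -> complex.Im z != 0 -> root_of f z ->
  `|f 0%N| <= M * r ^+ 2 / (1 - r) ^+ 2.
Proof.
move=> fM r0 r1 zr zi rz; rewrite -normc_real.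
exact: (quad_quotient_le fM r0 r1 zr zi rz 0%N).
Qed.

Lemma root_lead f M r z : (forall i, `|f i| <= M) -> 0 < r -> r < 1 ->
  normc z <= r -> root_of f z -> `|f 0%N| <= M * r / (1 - r).
Proof.
move=> fM r0 r1 zr rz; rewrite -normc_real.
exact: (root_quotient_le fM r0 r1 zr rz 0%N).
Qed.

Lemma psum_ge_half u r x n : (forall i, normc (u i) <= 2) -> u 0%N = 1 ->
  0 < r -> r <= 1 / 5 -> normc x <= r -> 1 / 2 <= normc (psum u n.+1 x).
Proof.
move=> u2 u0 r0 r5 xr; have x1 : normc x < 1 by lra.
have := psum_tail (n := 1) (m := n.+1) u2 x1 isT.
have -> : psum u 1 x = 1 by rewrite /psum big_ord1 u0 expr0 mulr1.
move=> h; have := normcB_ge 1 (1 - psum u n.+1 x).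
have -> : 1 - (1 - psum u n.+1 x) = psum u n.+1 x by ring.
rewrite normc1 [normc (1 - _)]normcBC expr1 in h * => h2.
have : 2 * normc x / (1 - normc x) <= 1 / 2.
  by rewrite ler_pdivrMr; have := normc_ge0 x; lra.
lra.
Qed.

(** Near the origin there is room for only one conjugate pair: dividing [g] by
the quadratic factor of its nonreal root [z] leaves a series of modulus at least
1/2, so [g] is small at [x] only if [x] is close to [z] or to its conjugate. *)
Lemma root_separation f g M r x z n :
  (forall i, `|f i| <= M) -> (forall i, `|g i| <= M) ->
  0 < r -> r <= 1 / 5 -> M * r ^+ 2 <= 2 * (1 - r) ^+ 2 ->
  g 0%N = 1 -> (forall i, (i <= n)%N -> f i = g i) ->
  normc x <= r -> root_of f x ->
  normc z <= r -> complex.Im z != 0 -> root_of g z ->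
  normc (x - z) * normc (x - z^*) <= 2 * (M + 1) * r ^+ n.+1.
Proof.
move=> fM gM r0 r5 Mr g0 fg xr rx zr zi rz; have r1 : r < 1 by lra.
have M0 : 0 <= M := le_trans (normr_ge0 _) (fM 0%N).
have z0 := rz.1; have zc0 : z^* != 0 by rewrite conjc_eq0.
pose T := divlin z^-1 (cseq g); pose q := quad_quotient g z.
have Tn := root_quotient_le gM r0 r1 zr rz n.
have qM i : normc (q i) <= 2.
  apply: le_trans (quad_quotient_le gM r0 r1 zr zi rz i) _.
  by rewrite ler_pdivrMr // exprn_gt0; lra.
have q0 : q 0%N = 1 by rewrite /q /quad_quotient /= /cseq g0.
have qx := psum_ge_half n qM q0 r0 r5 xr.
have fx : normc (psum (cseq g) n.+1 x) <= M * r ^+ n.+1 / (1 - r).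
  rewrite (_ : psum _ _ _ = psum (cseq f) n.+1 x); last first.
    by apply: psum_ext => i hi; rewrite /cseq fg.
  rewrite psum_divlin_root ?rx.1 // normcM normcX.
  have -> : M * r ^+ n.+1 / (1 - r) = r ^+ n * (M * r / (1 - r)).
    by rewrite exprS; ring.
  rewrite ler_pM ?exprn_ge0 ?normc_ge0 //.
    by rewrite lerXn2r ?nnegrE ?normc_ge0 // ltW.
  exact: (root_quotient_le fM r0 r1 xr rx).
have id : (x - z) * (x - z^*) * psum q n.+1 x =
    z * z^* * psum (cseq g) n.+1 x - z^* * x ^+ n.+1 * T n
    + (x - z) * x ^+ n.+1 * q n.
  rewrite (psum_divlin z^-1 (cseq g)) (psum_divlin (z^*)^-1 (divlin z^-1 _)).
  rewrite -/T -/q; have -> : q n = divlin (z^*)^-1 T n by [].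
  have -> : psum q n.+1 x = psum (divlin (z^*)^-1 T) n.+1 x by [].
  by field; rewrite z0 zc0.
have xn : normc (x ^+ n.+1) <= r ^+ n.+1.
  by rewrite normcX lerXn2r ?nnegrE ?normc_ge0 // ltW.
set p := r ^+ n.+1 in fx xn *; have p0 : 0 <= p by rewrite exprn_ge0 // ltW.
have inv : (1 - r)^-1 <= 5 / 4 by rewrite -[leRHS]invrK lef_pV2 ?posrE; lra.
have t1 : normc (z * z^* * psum (cseq g) n.+1 x) <= r * r * (M * p * (5 / 4)).
  rewrite !normcM normc_conj !ler_pM ?mulr_ge0 ?normc_ge0 //.
  by apply: le_trans fx _; rewrite ler_wpM2l ?mulr_ge0.
have t2 : normc (z^* * x ^+ n.+1 * T n) <= r * p * (M * r * (5 / 4)).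
  rewrite !normcM normc_conj !ler_pM ?mulr_ge0 ?normc_ge0 //.
  by apply: le_trans Tn _; rewrite ler_wpM2l ?mulr_ge0 // ltW.
have t3 : normc ((x - z) * x ^+ n.+1 * q n) <= (r + r) * p * 2.
  rewrite !normcM !ler_pM ?mulr_ge0 ?normc_ge0 //.
  by apply: le_trans (normcB_le _ _) _; apply: lerD.
have t : normc ((x - z) * (x - z^*) * psum q n.+1 x) <= (M + 1) * p.
  rewrite id; apply: le_trans (normc_leD _ _) _.
  have Mp : 0 <= M * p by rewrite mulr_ge0.
  have := normcB_le (z * z^* * psum (cseq g) n.+1 x) (z^* * x ^+ n.+1 * T n).
  have rr : r * r <= 1 / 25 by nra.
  have : r * r * (M * p * (5 / 4)) <= 1 / 25 * (M * p * (5 / 4)).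
    by rewrite ler_wpM2r // mulr_ge0 //; lra.
  have : (r + r) * p * 2 <= p by nra.
  by move=> h1 h2 h3; lra.
rewrite !normcM in t; have := mulr_ge0 (normc_ge0 (x - z)) (normc_ge0 (x - z^*)).
by nra.
Qed.

End Roots.

(** * Limits of roots, and Newton's method *)

Section Limits.
Local Open Scope complex_scope.
Variable R : realType.
Implicit Types (x y z : R[i]) (u : nat -> R[i]) (f g : nat -> R) (n m k : nat).

Lemma real_cauchy_limit (a e : nat -> R) :
  (forall n m, (n <= m)%N -> `|a n - a m| <= e n) ->
  exists l, forall n, `|a n - l| <= e n.
Proof.
move=> h.
have cross n m : a m - e m <= a n + e n.
  have [nm|mn] := leqP n m.
    have := h _ _ nm; have := h m m (leqnn m); rewrite subrr normr0 => h0.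
    by rewrite ler_norml => /andP[]; lra.
  have := h _ _ (ltnW mn); have := h n n (leqnn n); rewrite subrr normr0 => h0.
  by rewrite ler_norml => /andP[]; lra.
pose A := range (fun n => a n - e n).
have A0 : A !=set0 by exists (a 0%N - e 0%N); exists 0%N.
exists (sup A) => n.
have up : sup A <= a n + e n by apply: ge_sup => // _ [m _ <-].
have lo : a n - e n <= sup A.
  by apply: ub_le_sup; [exists (a n + e n) => _ [m _ <-] | exists n].
by rewrite ler_norml; apply/andP; split; lra.
Qed.

Lemma complex_cauchy_limit (x : nat -> R[i]) (e : nat -> R) :
  (forall n m, (n <= m)%N -> normc (x n - x m) <= e n) ->
  exists l, forall n, normc (x n - l) <= 2 * e n.
Proof.
move=> h.
have hR n m : (n <= m)%N -> `|complex.Re (x n) - complex.Re (x m)| <= e n.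
  by move=> /h; apply: le_trans; rewrite -raddfB normc_Re_le.
have hI n m : (n <= m)%N -> `|complex.Im (x n) - complex.Im (x m)| <= e n.
  by move=> /h; apply: le_trans; rewrite -raddfB normc_Im_le.
have [[a ha] [b hb]] := (real_cauchy_limit hR, real_cauchy_limit hI).
exists (a +i* b) => n; apply: le_trans (normc_ReIm_le _) _.
have := ha n; have := hb n; case: (x n) => p q /=; lra.
Qed.

Lemma expr_lip i x y : normc x <= 1 -> normc y <= 1 ->
  normc (x ^+ i - y ^+ i) <= i%:R * normc (x - y).
Proof.
move=> x1 y1; elim: i => [|i IH]; first by rewrite !expr0 subrr normc0 mul0r.
have -> : x ^+ i.+1 - y ^+ i.+1 = x * (x ^+ i - y ^+ i) + y ^+ i * (x - y).
  by rewrite !exprS; ring.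
apply: le_trans (normc_leD _ _) _; rewrite !normcM -natr1 mulrDl mul1r lerD //.
  by apply: le_trans IH; rewrite ler_piMl ?normc_ge0.
by rewrite normcX ler_piMl ?normc_ge0 // exprn_ile1 ?normc_ge0.
Qed.

Lemma psum_lip u n : exists2 K : R, 0 < K & forall x y, normc x <= 1 -> normc y <= 1 ->
  normc (psum u n x - psum u n y) <= K * normc (x - y).
Proof.
elim: n => [|n [K K0 IH]].
  by exists 1 => // x y _ _; rewrite /psum !big_ord0 subrr normc0 mul1r normc_ge0.
exists (K + normc (u n) * n%:R); first by rewrite ltr_wpDr // mulr_ge0 ?normc_ge0.
move=> x y x1 y1; rewrite !psumS.
have -> : psum u n x + u n * x ^+ n - (psum u n y + u n * y ^+ n) =
  (psum u n x - psum u n y) + u n * (x ^+ n - y ^+ n) by ring.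
apply: le_trans (normc_leD _ _) _; rewrite mulrDl lerD ?IH // normcM -mulrA.
by rewrite ler_wpM2l ?normc_ge0 // expr_lip.
Qed.

(** Truncations are continuous, and they are uniformly small at roots of series
that agree with [f] far enough. *)
Lemma root_limit f (M : R) (r : R) z :
  (forall i, `|f i| <= M) -> 1 <= `|f 0%N| -> 0 <= r -> r < 1 -> normc z < 1 ->
  (forall n (d : R), 0 < d -> exists x, exists g,
     [/\ normc x <= r, normc (x - z) < d, root_of g x, forall i, `|g i| <= M
       & forall i, (i < n)%N -> g i = f i]) ->
  root_of f z.
Proof.
move=> fM f0 r0 r1 z1 h.
have M0 : 0 <= M := le_trans (normr_ge0 _) (fM 0%N).
have small (e : R) : 0 < e -> forall N, exists2 m, (N < m)%N & normc (psum (cseq f) m z) < e.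
  move=> e0 N; have e2 : 0 < e / 2 by lra.
  have ep : 0 < e / 2 * (1 - r) / (M + 1).
    by apply: divr_gt0; [apply: mulr_gt0|]; lra.
  have [k hk] := exprn_small r0 r1 ep.
  pose m := (N + k)%N; exists m.+1; first by rewrite ltnS leq_addr.
  have rm : r ^+ m.+1 <= r ^+ k.
    by apply: ler_wiXn2l => //; [exact: ltW | rewrite leqW // leq_addl].
  have [K K0 hK] := psum_lip (cseq f) m.+1.
  have [x [g [xr xz gx gM gf]]] := h m.+1 _ (divr_gt0 e2 K0).
  have := hK z x (ltW z1) (le_trans xr (ltW r1)); rewrite (normcBC z) => h1.
  have h2 : K * normc (x - z) < e / 2 by rewrite mulrC -ltr_pdivlMr.
  have h3 : normc (psum (cseq f) m.+1 x) < e / 2.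
    have -> : psum (cseq f) m.+1 x = psum (cseq g) m.+1 x.
      by apply: psum_ext => i hi; rewrite /cseq gf.
    rewrite psum_divlin_root ?gx.1 // normcM normcX.
    have [r00|rp] := eqVneq r 0.
      by move: xr gx.1; rewrite r00 le_eqVlt normc_eq0 ltNge normc_ge0 orbF => ->.
    have rp' : 0 < r by rewrite lt0r rp.
    have hq := root_quotient_le gM rp' r1 xr gx m.
    have xm : normc x ^+ m <= r ^+ m by rewrite lerXn2r ?nnegrE ?normc_ge0.
    apply: le_lt_trans (ler_pM (exprn_ge0 _ (normc_ge0 _)) (normc_ge0 _) xm hq) _.
    have -> : r ^+ m * (M * r / (1 - r)) = M * r ^+ m.+1 / (1 - r).
      by rewrite exprS; ring.
    rewrite ltr_pdivrMr; last lra.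
    move: hk; rewrite ltr_pdivlMr; last lra.
    have := exprn_ge0 m.+1 r0; nra.
  have := normcB_triangle (psum (cseq f) m.+1 x) (psum (cseq f) m.+1 z) 0.
  rewrite !subr0 => h4; apply: le_lt_trans h4 _; lra.
have z0 : z != 0.
  apply/eqP => z0; have [m m0] := small 1 ltr01 0%N; apply/negP; rewrite -leNgt.
  case: m m0 => // m _; rewrite z0 /psum big_ord_recl big1 => [|i _]; last first.
    by rewrite expr0n mulr0.
  by rewrite expr0 mulr1 addr0 normc_real.
apply: (series_root_of_psum (M := M)) => // [i|e e0 N].
  exact: cseq_bound.
by have [m /ltnW] := small e e0 N; exists m.
Qed.

(** Newton iteration with a frozen derivative [c], applied to a sequence of
functions that changes by geometrically small amounts. *)
Lemma newton_limit (phi : nat -> R[i] -> R[i]) (c z : R[i]) (d eta : R) :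
  c != 0 -> 16 * eta <= d * normc c ->
  (forall k x y, normc (x - z) <= d -> normc (y - z) <= d ->
     normc (phi k x - phi k y - c * (x - y)) <= normc c / 2 * normc (x - y)) ->
  (forall k x, normc (x - z) <= d ->
     normc (phi k.+1 x - phi k x) <= eta * (1 / 2) ^+ k) ->
  normc (phi 0%N z) <= eta ->
  exists2 l, normc (l - z) <= d &
    exists K : R, forall k, normc (phi k l) <= K * (3 / 4) ^+ k.
Proof.
move=> c0 etad lin step start; set a := normc c in etad lin *.
have a0 : 0 < a by rewrite normc_gt0.
have eta0 : 0 <= eta := le_trans (normc_ge0 _) start.
pose x := fix x k := if k is j.+1 then x j - phi j (x j) / c else z.
pose A := 4 * eta / a; pose t : R := 3 / 4.
have A0 : 0 <= A by rewrite divr_ge0 ?(ltW a0) // mulr_ge0.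
have Aa : A * a = 4 * eta by rewrite divfK ?lt0r_neq0.
have A4d : 4 * A <= d by rewrite -(ler_pM2r a0) -mulrA Aa; lra.
have tS k : t ^+ k.+1 = 3 / 4 * t ^+ k by rewrite exprS.
have t0 k : 0 <= t ^+ k by apply: exprn_ge0; rewrite /t; lra.
have t1 k : t ^+ k <= 1 by apply: exprn_ile1; rewrite /t; lra.
have ht k : (1 / 2 : R) ^+ k <= t ^+ k by rewrite lerXn2r ?nnegrE /t //; lra.
have xS k : x k.+1 = x k - phi k (x k) / c by [].
have stepE k : x k.+1 - x k = - (phi k (x k) / c) by rewrite xS; ring.
have stepN k : normc (x k.+1 - x k) * a = normc (phi k (x k)).
  by rewrite stepE normc_opp normcM normcV divfK // lt0r_neq0.
have main k : normc (phi k (x k)) <= 4 * eta * t ^+ k /\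
              normc (x k - z) <= 4 * A * (1 - t ^+ k).
  elim: k => [|k [IH1 IH2]].
    by rewrite !expr0 /= !subrr normc0 !mulr0; split=> //; lra.
  have near : normc (x k.+1 - z) <= 4 * A * (1 - t ^+ k.+1).
    have := normcB_triangle (x k) (x k.+1) z.
    have : normc (x k.+1 - x k) <= A * t ^+ k.
      by rewrite -(ler_pM2r a0) stepN mulrAC Aa.
    by rewrite tS; lra.
  split=> //.
  have kd : normc (x k - z) <= d by have := t0 k; nra.
  have k1d : normc (x k.+1 - z) <= d by have := t0 k.+1; nra.
  have l := lin k _ _ k1d kd.
  have e0 : phi k (x k.+1) - phi k (x k) - c * (x k.+1 - x k) = phi k (x k.+1).
    by rewrite stepE; field.
  rewrite e0 mulrAC -[a * _]mulrC stepN in l.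
  have := normcB_triangle (phi k (x k.+1)) (phi k.+1 (x k.+1)) 0.
  rewrite !subr0; have := step k _ k1d; have := ht k.
  rewrite tS => h1 h2 h3.
  have : eta * (1 / 2) ^+ k <= eta * t ^+ k by rewrite ler_wpM2l.
  lra.
have cauchy n m : (n <= m)%N -> normc (x n - x m) <= 4 * A * t ^+ n.
  have h j : normc (x (j + n)%N - x n) <= 4 * A * (t ^+ n - t ^+ (j + n)).
    elim: j => [|j IHj]; first by rewrite add0n !subrr normc0 mulr0.
    have := normcB_triangle (x (j + n)%N) (x (j.+1 + n)%N) (x n).
    have : normc (x (j.+1 + n)%N - x (j + n)%N) <= A * t ^+ (j + n).
      by rewrite -(ler_pM2r a0) addSn stepN mulrAC Aa (main _).1.
    by rewrite addSn tS; lra.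
  move=> /subnK <-; rewrite normcBC; apply: le_trans (h _) _.
  by apply: ler_wpM2l; [exact: mulr_ge0 | rewrite gerBl].
have [l hl] := complex_cauchy_limit cauchy.
have ld : normc (l - z) <= d.
  have [tp t_lt1] : 0 <= t /\ t < 1 by rewrite /t; split; lra.
  apply: le_trans A4d; apply: (le_of_geometric (K := 8 * A) (N := 0) tp t_lt1).
  move=> n _; have := normcB_triangle (x n) l z; rewrite (normcBC l (x n)).
  by have := hl n; have := (main n).2; have := mulr_ge0 A0 (t0 n); lra.
exists l => //; exists (4 * eta + 12 * (A * a)) => k.
have kd : normc (x k - z) <= d by have := (main k).2; have := t0 k; nra.
have h1 := lin k l (x k) ld kd.
have h2 : normc (l - x k) <= 8 * A * t ^+ k.
  by rewrite normcBC; apply: le_trans (hl k) _; lra.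
have h3 : a * normc (l - x k) <= 8 * (A * a) * t ^+ k.
  by apply: le_trans (ler_wpM2l (ltW a0) h2) _; lra.
have h4 := normc_leD (phi k l - phi k (x k) - c * (l - x k)) (c * (l - x k) + phi k (x k)).
have e4 : phi k l - phi k (x k) - c * (l - x k) + (c * (l - x k) + phi k (x k)) = phi k l.
  by ring.
rewrite e4 in h4.
have h5 := normc_leD (c * (l - x k)) (phi k (x k)); rewrite normcM -/a in h5.
by have := (main k).1; rewrite -/t; lra.
Qed.

End Limits.

(** * Stability of simple roots *)

Section Perturbation.
Local Open Scope complex_scope.
Variable R : realType.
Implicit Types (x y z : R[i]) (u : nat -> R[i]) (f g : nat -> R) (n m k : nat).

Local Notation half := (1 / 2 : R).

Lemma halfX_ge0 i : 0 <= half ^+ i.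
Proof. by apply: exprn_ge0; lra. Qed.

Lemma quarterX_le i : (1 / 4 : R) ^+ i <= half ^+ i.
Proof. by rewrite lerXn2r ?nnegrE //; lra. Qed.

Lemma normcX_le_quarter z i : normc z <= 1 / 4 -> normc (z ^+ i) <= (1 / 4) ^+ i.
Proof.
by move=> hz; rewrite normcX lerXn2r ?nnegrE ?normc_ge0 //; lra.
Qed.

(** On the disc of radius 1/4, factors polynomial in [i] are absorbed by
replacing [(1 / 4) ^+ i] with [(1 / 2) ^+ i]. *)
Lemma exprB_quarter i x y : normc x <= 1 / 4 -> normc y <= 1 / 4 ->
  normc (x ^+ i - y ^+ i) <= 4 * half ^+ i * normc (x - y).
Proof.
move=> x1 y1; have d0 := normc_ge0 (x - y).
elim: i => [|i IH]; first by rewrite !expr0 subrr normc0 mulr1 mulr_ge0.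
have -> : x ^+ i.+1 - y ^+ i.+1 = x * (x ^+ i - y ^+ i) + y ^+ i * (x - y).
  by rewrite !exprS; ring.
apply: le_trans (normc_leD _ _) _; rewrite !normcM [half ^+ i.+1]exprS.
have h1 := ler_pM (normc_ge0 x) (normc_ge0 _) x1 IH.
have h2 := ler_wpM2r d0 (le_trans (normcX_le_quarter i y1) (quarterX_le i)).
by have := mulr_ge0 (halfX_ge0 i) d0; lra.
Qed.

Lemma natr_quarterX_le i : i%:R * (1 / 4 : R) ^+ i.-1 <= 4 * half ^+ i.
Proof.
case: i => [|i]; first by rewrite mul0r mulr_ge0 ?halfX_ge0.
rewrite [i.+1.-1]/=; suff : i.+1%:R * (1 / 4 : R) ^+ i <= half ^+ i.
  by rewrite exprS; have := halfX_ge0 i; lra.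
elim: i => [|i IH]; first by rewrite !expr0; lra.
rewrite !exprS -natr1 mulrDl.
have i1 : 1 <= i.+1%:R :> R by rewrite ler1n.
have q0 : 0 <= (1 / 4 : R) ^+ i by apply: exprn_ge0; lra.
by nra.
Qed.

Definition dsum u n z : R[i] := \sum_(i < n) i%:R * u i * z ^+ i.-1.

Lemma dsumS u n z : dsum u n.+1 z = dsum u n z + n%:R * u n * z ^+ n.-1.
Proof. by rewrite /dsum big_ord_recr. Qed.

Lemma normc_nat n : normc (n%:R : R[i]) = n%:R :> R.
Proof.
have -> : (n%:R : R[i]) = (n%:R)%:C by rewrite rmorph_nat.
by rewrite normc_real ger0_norm // ler0n.
Qed.

Lemma deriv_term_le i z : normc z <= 1 / 4 ->
  normc (i%:R * z ^+ i.-1) <= 4 * half ^+ i.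
Proof.
move=> hz; rewrite normcM normc_nat; apply: le_trans (natr_quarterX_le i).
by rewrite ler_wpM2l ?ler0n // normcX_le_quarter.
Qed.

Lemma expr_taylor i x y z d : normc x <= 1 / 4 -> normc y <= 1 / 4 ->
  normc z <= 1 / 4 -> normc (x - z) <= d -> normc (y - z) <= d ->
  normc (x ^+ i - y ^+ i - i%:R * z ^+ i.-1 * (x - y)) <= 32 * half ^+ i * d * normc (x - y).
Proof.
move=> x1 y1 z1 xd yd; have e0 := normc_ge0 (x - y).
have d0 : 0 <= d := le_trans (normc_ge0 _) xd.
elim: i => [|i IH].
  by rewrite !expr0 subrr mul0r mul0r subrr normc0 !mulr_ge0 ?halfX_ge0.
set E := x ^+ i - y ^+ i - _ in IH.
have -> : x ^+ i.+1 - y ^+ i.+1 - i.+1%:R * z ^+ i.+1.-1 * (x - y) =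
    x * E + (i%:R * z ^+ i.-1 * (x - z) + (y ^+ i - z ^+ i)) * (x - y).
  rewrite /E; case: i {IH E} => [|i]; first by rewrite !expr0 expr1 /=; ring.
  by rewrite [i.+2.-1]/= [i.+1.-1]/= !exprS -[i.+2%:R]natr1; ring.
apply: le_trans (normc_leD _ _) _; rewrite !normcM [half ^+ i.+1]exprS.
have h1 := ler_pM (normc_ge0 x) (normc_ge0 _) x1 IH.
have h2 := ler_pM (normc_ge0 _) (normc_ge0 _) (deriv_term_le i z1) xd.
have h3 : normc (y ^+ i - z ^+ i) <= 4 * half ^+ i * d.
  by apply: le_trans (exprB_quarter i y1 z1) _; rewrite ler_wpM2l // mulr_ge0 ?halfX_ge0.
have h4 : normc (i%:R * z ^+ i.-1 * (x - z) + (y ^+ i - z ^+ i)) <= 8 * half ^+ i * d.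
  by apply: le_trans (normc_leD _ _) _; rewrite normcM; lra.
have h5 := ler_wpM2r e0 h4.
lra.
Qed.

Lemma sum_halfX n : \sum_(i < n) half ^+ i <= 2.
Proof.
have [h0 h1] : 0 <= half /\ half < 1 by split; lra.
apply: le_trans (sum_geometric_le n h0 h1) _.
by rewrite (_ : (1 - half)^-1 = 2) //; field.
Qed.

Lemma psum_taylor u (M : R) n x y z d : (forall i, normc (u i) <= M) ->
  normc x <= 1 / 4 -> normc y <= 1 / 4 ->
  normc z <= 1 / 4 -> normc (x - z) <= d -> normc (y - z) <= d ->
  normc (psum u n x - psum u n y - dsum u n z * (x - y)) <= 64 * M * d * normc (x - y).
Proof.
move=> uM x1 y1 z1 xd yd; have e0 := normc_ge0 (x - y).
have d0 : 0 <= d := le_trans (normc_ge0 _) xd.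
have M0 : 0 <= M := le_trans (normc_ge0 _) (uM 0%N).
pose t i := u i * (x ^+ i - y ^+ i - i%:R * z ^+ i.-1 * (x - y)).
have -> : psum u n x - psum u n y - dsum u n z * (x - y) = \sum_(i < n) t i.
  rewrite /psum /dsum mulr_suml -!sumrB; apply: eq_bigr => i _; rewrite /t; ring.
apply: le_trans (normc_sum _ t) _.
apply: (@le_trans _ _ (\sum_(i < n) (32 * M * d * normc (x - y)) * half ^+ i)).
  apply: ler_sum => i _; rewrite /t normcM.
  have := ler_pM (normc_ge0 _) (normc_ge0 _) (uM i) (expr_taylor i x1 y1 z1 xd yd).
  by move/le_trans; apply; rewrite le_eqVlt; apply/orP; left; apply/eqP; ring.
rewrite -mulr_sumr.
have k0 : 0 <= 32 * M * d * normc (x - y) by rewrite !mulr_ge0.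
by have := ler_wpM2l k0 (sum_halfX n); lra.
Qed.

Lemma dsum_tail u (M : R) n k z : (forall i, normc (u i) <= M) -> normc z <= 1 / 4 ->
  normc (dsum u (n + k) z - dsum u n z) <= 8 * M * half ^+ n.
Proof.
move=> uM z1; have M0 : 0 <= M := le_trans (normc_ge0 _) (uM 0%N).
suff H : normc (dsum u (n + k) z - dsum u n z) <= 8 * M * (half ^+ n - half ^+ (n + k)).
  by apply: le_trans H _; have := mulr_ge0 M0 (halfX_ge0 (n + k)); lra.
elim: k => [|k IH]; first by rewrite addn0 !subrr normc0 mulr0.
rewrite addnS dsumS; have := normcB_triangle (dsum u (n + k) z)
  (dsum u (n + k) z + (n + k)%:R * u (n + k)%N * z ^+ (n + k).-1) (dsum u n z).
rewrite [_ + _ - dsum u (n + k) z]addrAC subrr add0r.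
have -> : (n + k)%:R * u (n + k)%N * z ^+ (n + k).-1 =
   u (n + k)%N * ((n + k)%:R * z ^+ (n + k).-1) by ring.
rewrite [normc (u _ * _)]normcM.
have := ler_pM (normc_ge0 _) (normc_ge0 _) (uM (n + k)%N) (deriv_term_le (n + k) z1).
by rewrite [half ^+ (n + k).+1]exprS; lra.
Qed.

(** Differentiating [u = (1 - X / z) T] at [z] leaves [- T(z) / z], up to the
boundary term of the truncation. *)
Lemma dsum_root u n z : z != 0 ->
  z * dsum u n.+1 z = n%:R * z ^+ n * divlin z^-1 u n - psum (divlin z^-1 u) n z.
Proof.
move=> z0; elim: n => [|n IH].
  by rewrite /dsum /psum big_ord1 big_ord0 !mul0r mulr0 subrr.
rewrite dsumS psumS mulrDr IH /= -[n.+1%:R]natr1 exprS; field.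
by [].
Qed.

(** The root is simple: the derivative is [- T(z) / z] with
[T = (1 - X / z^* ) q], and [q] stays away from zero near the origin. *)
Lemma dsum_lower f M r z :
  (forall i, `|f i| <= M) -> f 0%N = 1 -> 0 < r -> r <= 1 / 5 ->
  M * r ^+ 2 <= 2 * (1 - r) ^+ 2 ->
  normc z <= r -> complex.Im z != 0 -> root_of f z ->
  exists2 c : R, 0 < c & exists N, forall n, (N <= n)%N -> c <= normc (dsum (cseq f) n z).
Proof.
move=> fM f0 r0 r5 Mr zr zi rz; have r1 : r < 1 by lra.
have M0 : 0 <= M := le_trans (normr_ge0 _) (fM 0%N).
have [z0 _] := rz; have zc0 : z^* != 0 by rewrite conjc_eq0.
have z4 : normc z <= 1 / 4 by lra.
pose T := divlin z^-1 (cseq f); pose q := quad_quotient f z.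
have TM i : normc (T i) <= M.
  apply: le_trans (root_quotient_le fM r0 r1 zr rz i) _.
  by rewrite ler_pdivrMr; [nra | lra].
have qM i : normc (q i) <= 2.
  apply: le_trans (quad_quotient_le fM r0 r1 zr zi rz i) _.
  by rewrite ler_pdivrMr // exprn_gt0; lra.
have q0 : q 0%N = 1 by rewrite /q /quad_quotient /= /cseq f0.
pose e := normc (1 - (z^*)^-1 * z).
have e0 : 0 < e.
  rewrite normc_gt0 subr_eq0 eq_sym; apply: contra (nonreal_neq_conj zi) => /eqP h1.
  by rewrite -[X in _ == X]mulr1 -h1 mulrA mulfV // mul1r.
have low n : e / 2 - (4 + 4 * M) * half ^+ n <= normc (dsum (cseq f) n.+2 z).
  have z1 : normc z <= 1 by lra.
  apply: (@le_trans _ _ (normc (z * dsum (cseq f) n.+2 z))); last first.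
    by rewrite normcM ler_piMl ?normc_ge0.
  rewrite dsum_root // (psum_divlin (z^*)^-1) -/T -/q.
  have -> : divlin (z^*)^-1 T = q by [].
  set P := psum q n.+1 z.
  have P2 : 1 / 2 <= normc P := psum_ge_half n qM q0 r0 r5 zr.
  have h1 : normc (n.+1%:R * z ^+ n.+1 * T n.+1) <= 4 * half ^+ n * M.
    have -> : n.+1%:R * z ^+ n.+1 * T n.+1 = z * (n.+1%:R * z ^+ n.+1.-1) * T n.+1.
      by rewrite [n.+1.-1]/= exprS; ring.
    rewrite normcM ler_pM ?normc_ge0 ?mulr_ge0 //.
    rewrite normcM; have := ler_pM (normc_ge0 _) (normc_ge0 _) z4 (deriv_term_le n.+1 z4).
    by rewrite exprS; have := halfX_ge0 n; lra.
  have h2 : normc ((z^*)^-1 * z ^+ n.+1 * q n) <= 2 * half ^+ n.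
    have -> : (z^*)^-1 * z ^+ n.+1 * q n = (z^*)^-1 * z * (q n * z ^+ n).
      by rewrite exprS; ring.
    have e1 : normc ((z^*)^-1 * z) = 1 by rewrite normcM normcV normc_conj mulVf ?normc_eq0.
    rewrite normcM e1 [leLHS]mul1r normcM ler_pM ?normc_ge0 //.
    exact: le_trans (normcX_le_quarter n z4) (quarterX_le n).
  have := normcB_ge ((1 - (z^*)^-1 * z) * P)
    (n.+1%:R * z ^+ n.+1 * T n.+1 - (z^*)^-1 * z ^+ n.+1 * q n).
  have := normcB_le (n.+1%:R * z ^+ n.+1 * T n.+1) ((z^*)^-1 * z ^+ n.+1 * q n).
  rewrite [normc (_ * P)]normcM -/e => h3.
  rewrite [X in _ <= X -> _](_ : _ = normc (n.+1%:R * z ^+ n.+1 * T n.+1 -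
    ((1 - (z^*)^-1 * z) * P + (z^*)^-1 * z ^+ n.+1 * q n))); last first.
    by rewrite normcBC; congr normc; ring.
  have := halfX_ge0 n; have : e / 2 <= e * normc P by nra.
  by nra.
exists (e / 4); first by lra.
have ep : 0 < e / 4 / (4 + 4 * M + 1) by apply: divr_gt0; lra.
have h0 : (0 : R) <= half by lra.
have h1 : half < 1 :> R by lra.
have [N hN] := exprn_small h0 h1 ep; exists N.+2 => -[|[|n]] //; rewrite !ltnS => Nn.
apply: le_trans (low n).
have : half ^+ n <= half ^+ N :> R by apply: ler_wiXn2l => //; exact: ltW.
move: hN; rewrite ltr_pdivlMr; last lra.
by have := halfX_ge0 n; nra.
Qed.

Lemma pos_lower_bound (a b : R) : 0 < a -> 0 < b -> exists2 d, 0 < d & d < a /\ d < b.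
Proof.
move=> a0 b0; have m0 : 0 < Num.min a b by rewrite lt_min a0.
have : Num.min a b <= a by rewrite ge_min lexx.
have : Num.min a b <= b by rewrite ge_min lexx orbT.
by exists (Num.min a b / 2); [lra | split; lra].
Qed.

(** An approximate root of the truncation of order [n] is the starting point of
a Newton iteration through the truncations of higher orders. *)
Lemma series_newton u (M : R) n z (d : R) :
  (forall i, normc (u i) <= M) -> 0 <= M -> 0 < d -> d < normc z ->
  normc z + d <= 1 / 4 -> d <= 1 / 20 -> let c := normc (dsum u n z) in 0 < c ->
  256 * M * d <= c -> 400 * (M * half ^+ n) <= d * c -> normc (psum u n z) <= 2 * M * half ^+ n ->
  exists2 x, normc (x - z) <= d & series_root u x.
Proof.
move=> uM M0 d0 dz zd4 d20 c c0 dc nc start.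
pose C := dsum u n z; have C0 : C != 0 by rewrite -normc_gt0.
have near x : normc (x - z) <= d -> normc x <= 1 / 4.
  by have := normcB_triangle z x 0; rewrite !subr0; lra.
have z4 : normc z <= 1 / 4 by lra.
have Mh0 : 0 <= M * half ^+ n := mulr_ge0 M0 (halfX_ge0 n).
have nc8 : 8 * M * half ^+ n <= c / 4.
  have : d * c <= 1 / 20 * c by rewrite ler_wpM2r // ltW.
  lra.
have lin k x y : normc (x - z) <= d -> normc (y - z) <= d ->
    normc (psum u (n + k) x - psum u (n + k) y - C * (x - y)) <= normc C / 2 * normc (x - y).
  move=> xd yd; have T := psum_taylor (n + k) uM (near _ xd) (near _ yd) z4 xd yd.
  have D := dsum_tail n k uM z4; have e0 := normc_ge0 (x - y).
  have -> : psum u (n + k) x - psum u (n + k) y - C * (x - y) =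
    (psum u (n + k) x - psum u (n + k) y - dsum u (n + k) z * (x - y))
    + (dsum u (n + k) z - C) * (x - y) by ring.
  apply: le_trans (normc_leD _ _) _; rewrite [normc (_ * (x - y))]normcM.
  have D2 := ler_wpM2r e0 D.
  have h1 : 64 * M * d * normc (x - y) <= c / 4 * normc (x - y).
    by rewrite ler_wpM2r //; lra.
  have h2 : 8 * M * half ^+ n * normc (x - y) <= c / 4 * normc (x - y) by rewrite ler_wpM2r.
  by rewrite -/c -/C in D2 *; lra.
have step k x : normc (x - z) <= d ->
    normc (psum u (n + k.+1) x - psum u (n + k) x) <= 2 * M * half ^+ n * half ^+ k.
  move=> xd; rewrite addnS psumS addrC addKr normcM.
  have := ler_pM (normc_ge0 _) (normc_ge0 _) (uM (n + k)%N)
     (le_trans (normcX_le_quarter (n + k) (near _ xd)) (quarterX_le (n + k))).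
  by rewrite [half ^+ (n + k)]exprD; have := mulr_ge0 Mh0 (halfX_ge0 k); lra.
have start0 : normc (psum u (n + 0) z) <= 2 * M * half ^+ n by rewrite addn0.
have eta : 16 * (2 * M * half ^+ n) <= d * normc C by rewrite -/c; lra.
have [x xd [K hK]] := newton_limit (phi := fun k => psum u (n + k)) C0 eta lin step start0.
exists x => //; apply: (series_root_of_psum uM).
- by apply/eqP => x0; move: xd; rewrite x0 sub0r normc_opp; lra.
- by apply: le_lt_trans (near _ xd) _; lra.
move=> e e0 m; have t0 : 0 <= 3 / 4 :> R by lra.
have t1 : 3 / 4 < 1 :> R by lra.
have K1 : 0 < `|K| + 1 by apply: ltr_wpDl.
have [k hk] := exprn_small t0 t1 (divr_gt0 e0 K1).
exists (n + (m + k))%N; first by rewrite addnCA leq_addr.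
apply: le_lt_trans (hK _) _; move: hk; rewrite ltr_pdivlMr // => hk.
have mk : (3 / 4) ^+ (m + k) <= (3 / 4) ^+ k :> R.
  by apply: ler_wiXn2l; [|exact: ltW|rewrite leq_addl].
apply: (@le_lt_trans _ _ ((`|K| + 1) * (3 / 4) ^+ (m + k))).
  by rewrite ler_wpM2r ?exprn_ge0 //; apply: le_trans (ler_norm _) _; rewrite lerDl.
by apply: le_lt_trans hk; rewrite mulrC ler_wpM2r // ltW.
Qed.

(** Hurwitz: a simple root survives a perturbation of the far coefficients. *)
Lemma root_perturb f M r z (d : R) :
  (forall i, `|f i| <= M) -> f 0%N = 1 -> 0 < r -> r <= 1 / 5 ->
  M * r ^+ 2 <= 2 * (1 - r) ^+ 2 ->
  normc z <= r -> complex.Im z != 0 -> root_of f z -> 0 < d ->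
  exists n, forall g, (forall i, `|g i| <= M) -> (forall i, (i < n)%N -> g i = f i) ->
    exists2 x, normc (x - z) < d & root_of g x.
Proof.
move=> fM f0 r0 r5 Mr zr zi rz d0.
have M1 : 1 <= M by have := fM 0%N; rewrite f0 normr1.
have [c c0 [N hc]] := dsum_lower fM f0 r0 r5 Mr zr zi rz.
have nz : 0 < normc z by rewrite normc_gt0 rz.1.
have cM : 0 < c / (256 * M) by apply: divr_gt0; lra.
have q20 : 0 < 1 / 20 :> R by lra.
have [s s0 [sd sz sc s20]] : exists2 s : R, 0 < s &
    [/\ s < d, s < normc z, 256 * M * s <= c & s <= 1 / 20].
  have [a a0 [ad az]] := pos_lower_bound d0 nz.
  have [b b0 [bc b20]] := pos_lower_bound cM q20.
  have [s s0 [sa sb]] := pos_lower_bound a0 b0.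
  exists s => //; split; [exact: lt_trans ad|exact: lt_trans az| |].
    by have := ltW (lt_trans sb bc); rewrite ler_pdivlMr; lra.
  exact/ltW/(lt_trans sb).
have h0 : (0 : R) <= half by lra.
have h1 : half < 1 :> R by lra.
have ep : 0 < s * c / (400 * M) by apply: divr_gt0; [exact: mulr_gt0 | lra].
have [N2 hN2] := exprn_small h0 h1 ep.
pose n := (N + N2).+1; exists n => g gM gf.
have hn : 400 * (M * half ^+ n) <= s * c.
  have M0 : 0 <= M by lra.
  have hh : M * half ^+ n <= M * half ^+ N2.
    apply: ler_wpM2l => //.
    by apply: ler_wiXn2l; [|exact: ltW|rewrite leqW // leq_addl].
  have M400 : 0 < 400 * M by lra.
  by move: hN2; rewrite ltr_pdivlMr // => hN2; lra.
have CE : dsum (cseq g) n z = dsum (cseq f) n z.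
  by apply: eq_bigr => i _; rewrite /cseq gf.
have Cc : c <= normc (dsum (cseq g) n z) by rewrite CE hc // leqW // leq_addr.
have start : normc (psum (cseq g) n z) <= 2 * M * half ^+ n.
  have -> : psum (cseq g) n z = psum (cseq f) n z.
    by apply: psum_ext => i hi; rewrite /cseq gf.
  have z1 : normc z < 1 by lra.
  have fM' i : normc (cseq f i) <= M by apply: cseq_bound.
  apply: le_trans (series_root_psum fM' z1 rz (N + N2)) _; rewrite -/n.
  have hz : normc z ^+ n <= half ^+ n by rewrite lerXn2r ?nnegrE ?normc_ge0 //; lra.
  rewrite ler_pdivrMr; last lra.
  have p1 : M * normc z ^+ n <= M * half ^+ n by rewrite ler_wpM2l //; lra.
  have Mh0 : 0 <= M * half ^+ n by apply: mulr_ge0 (halfX_ge0 n); lra.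
  have p2 : 0 <= M * half ^+ n * (1 - normc z - 3 / 4) by apply: mulr_ge0 => //; lra.
  lra.
have gM' i : normc (cseq g i) <= M by apply: cseq_bound.
have cp : 0 < normc (dsum (cseq g) n z) by lra.
have M0 : 0 <= M by lra.
have zs4 : normc z + s <= 1 / 4 by lra.
have sc' : 256 * M * s <= normc (dsum (cseq g) n z) by lra.
have nc : 400 * (M * half ^+ n) <= s * normc (dsum (cseq g) n z).
  by apply: le_trans hn _; rewrite ler_wpM2l // ltW.
have [x xs rx] := series_newton gM' M0 s0 sz zs4 s20 cp sc' nc start.
by exists x => //; apply: le_lt_trans sd.
Qed.

End Perturbation.

(** * Series as words over a finite set of digits *)

Section Words.
Local Open Scope complex_scope.
Variables (R : realType) (S : {fset R}).
Implicit Types (z : R[i]) (f g : nat -> R) (n k : nat).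

Definition coefs f := forall i, f i \in S.

Definition agree n f g := forall i, (i < n)%N -> f i = g i.

Lemma agree_sym n f g : agree n f g -> agree n g f.
Proof. by move=> h i /h. Qed.

Lemma agree_trans n g f l : agree n f g -> agree n g l -> agree n f l.
Proof. by move=> h h' i hi; rewrite h // h'. Qed.

Lemma agree_leq n m f g : (n <= m)%N -> agree m f g -> agree n f g.
Proof. by move=> nm h i hi; apply: h; apply: leq_trans nm. Qed.

Definition upd f n (s : R) i := if i == n then s else f i.

Lemma agree_updS n f g : agree n g f -> agree n.+1 g (upd f n (g n)).
Proof.
move=> h i; rewrite ltnS leq_eqVlt /upd => /orP[/eqP ->|hi]; first by rewrite eqxx.
by rewrite ltn_eqF // h.
Qed.

(** Dependent choice, one letter at a time. *)
Lemma path_extension (P : nat -> (nat -> R) -> Prop) n0 f0 :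
  (forall n f g, agree n f g -> P n f -> P n g) ->
  (forall n f, (n0 <= n)%N -> P n f -> exists2 s, s \in S & P n.+1 (upd f n s)) ->
  P n0 f0 ->
  exists f, [/\ agree n0 f f0, forall i, (n0 <= i)%N -> f i \in S &
    forall n, (n0 <= n)%N -> P n f].
Proof.
move=> Pext Pstep P0.
have /choice [next hnext] : forall nf : nat * (nat -> R), exists s,
    (n0 <= nf.1)%N -> P nf.1 nf.2 -> s \in S /\ P nf.1.+1 (upd nf.2 nf.1 s).
  case=> n f /=; have [[h1 h2]|h] := pselect ((n0 <= n)%N /\ P n f).
    by have [s s1 s2] := Pstep n f h1 h2; exists s.
  by exists 0 => h1 h2; case: h.
pose F := fix F k := if k is j.+1 then
  upd (F j) (n0 + j) (next ((n0 + j)%N, F j)) else f0.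
have PF k : P (n0 + k)%N (F k).
  elim: k => [|k IH]; first by rewrite addn0.
  by rewrite addnS; exact: (hnext (_, _) (leq_addr _ _) IH).2.
pose f i := F (i.+1 - n0)%N i.
have stable k j : agree (n0 + k) (F (k + j)%N) (F k).
  elim: j => [|j IH]; first by rewrite addn0.
  rewrite addnS => i hi; rewrite -(IH i hi) /= /upd ltn_eqF //.
  by rewrite (leq_trans hi) // addnA leq_addr.
have fF k : agree (n0 + k) f (F k).
  move=> i hi; rewrite /f; have hk : (i.+1 - n0 <= k)%N by rewrite leq_subLR.
  rewrite -(subnK hk) addnC stable //.
  by rewrite -maxnE leq_max leqnn orbT.
exists f; split=> [|i hi|n hn].
- by have := fF 0%N; rewrite addn0.
- rewrite /f subSn //= /upd subnKC // eqxx.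
  by apply: (hnext (_, _) _ _).1 => //=; have := PF (i - n0)%N; rewrite subnKC.
- rewrite -(subnKC hn); apply: Pext (PF _).
  exact/agree_sym/fF.
Qed.

Lemma seq_uniform (l : seq R) (Q : R -> R -> Prop) :
  (forall s d e, 0 < e -> e <= d -> Q s d -> Q s e) ->
  (forall s, s \in l -> exists2 d, 0 < d & Q s d) ->
  exists2 d, 0 < d & forall s, s \in l -> Q s d.
Proof.
move=> Qm; elim: l => [|s l IH] h; first by exists 1.
have [d d0 hd] := h s (mem_head _ _).
have [|e e0 he] := IH; first by move=> t tl; apply: h; rewrite in_cons tl orbT.
have m0 : 0 < Num.min d e by rewrite lt_min d0.
exists (Num.min d e) => // t; rewrite in_cons => /orP[/eqP ->|tl].
  by apply: Qm hd => //; rewrite ge_min lexx.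
by apply: Qm (he t tl) => //; rewrite ge_min lexx orbT.
Qed.

(** Koenig's lemma: if series with roots in [T] accumulate at [z], then so do,
for some fixed [f], such series that agree with [f] arbitrarily far. *)
Lemma root_accumulation (T : R[i] -> Prop) z n0 f0 :
  (forall d : R, 0 < d -> exists x, exists g,
     [/\ T x, normc (x - z) < d, coefs g, agree n0 g f0 & root_of g x]) ->
  exists f, [/\ coefs f, agree n0 f f0 &
    forall n (d : R), 0 < d -> exists x, exists g,
     [/\ T x, normc (x - z) < d, coefs g, agree n g f & root_of g x]].
Proof.
move=> h0.
pose Q n f (d : R) := exists x, exists g,
  [/\ T x, normc (x - z) < d, coefs g, agree n g f & root_of g x].
have Qm n f d e : 0 < e -> e <= d -> Q n f e -> Q n f d.
  by move=> e0 ed [x [g [? h ? ? ?]]]; exists x, g; split=> //; apply: lt_le_trans ed.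
have [|||f [ff0 fS Pf]] := @path_extension
  (fun n f => forall d : R, 0 < d -> Q n f d) n0 f0.
- move=> n f g fg hf d d0; have [x [l [? ? ? lf ?]]] := hf d d0; exists x, l.
  by split=> //; apply: agree_trans fg.
- move=> n f hn hf; apply: contrapT => hno.
  have [|s d|d d0 hd] := @seq_uniform S (fun s d => ~ Q n.+1 (upd f n s) d).
  + by move=> s d e e0 ed hq hq'; apply: hq; apply: Qm hq'.
  + apply: contrapT => hs; apply: hno; exists s => // e e0.
    by apply: contrapT => he; apply: hs; exists e.
  + have [x [g [Tx xd gS gf gx]]] := hf d d0.
    apply: (hd (g n) (gS n)); exists x, g; split=> //; exact: agree_updS.
- exact: h0.
exists f; split=> // [i|n d d0].
- have [in0|ni] := ltnP i n0; last exact: fS.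
  by have [x [g [_ _ gS gf _]]] := Pf n0 (leqnn _) 1 ltr01; rewrite -gf.
- have [nn0|n0n] := leqP n n0; last exact: Pf (ltnW n0n) _ d0.
  have [x [g [? ? ? gf ?]]] := Pf n0 (leqnn _) d d0; exists x, g; split=> //.
  exact: agree_leq gf.
Qed.

(** If [P] took both values on a cylinder, some next letter would keep it so
-- otherwise [P] would be a function of that letter, and constant along the
chain of letters -- and the resulting infinite word would contradict local
constancy. *)
Lemma cylinder_constant (P : (nat -> R) -> Prop) n0 f0 :
  (forall Q : R -> Prop, (forall a b, a \in S -> b \in S -> a < b -> b <= a + 2 ->
     (Q a <-> Q b)) -> forall a b, a \in S -> b \in S -> Q a -> Q b) ->
  (forall n f a b, (n0 <= n)%N -> coefs f -> agree n0 f f0 ->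
     a \in S -> b \in S -> a < b -> b <= a + 2 ->
     exists g, exists l, [/\ coefs g, coefs l, agree n g f /\ agree n l f,
       g n = a /\ l n = b & P g <-> P l]) ->
  (forall f, coefs f -> agree n0 f f0 ->
     exists n, forall g, coefs g -> agree n g f -> (P g <-> P f)) ->
  forall f g, coefs f -> coefs g -> agree n0 f f0 -> agree n0 g f0 -> P f -> P g.
Proof.
move=> chain adj loc f1 g1 f1S g1S f1f0 g1f0 Pf1; apply: contrapT => nPg1.
pose mixed n f := exists g, exists l, [/\ coefs g /\ coefs l,
  agree n g f /\ agree n l f, agree n0 g f0 /\ agree n0 l f0 & P g /\ ~ P l].
have [|||f [ff0 fS mf]] := @path_extension mixed n0 f0.
- move=> n f g fg [l [m [c [a1 a2] b p]]]; exists l, m; split=> //.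
  by split; [exact: agree_trans a1 fg | exact: agree_trans a2 fg].
- move=> n f n0n [g [l [[gS lS] [gf lf] [gf0 lf0] [Pg nPl]]]].
  apply: contrapT => hno.
  have pure g' l' : coefs g' -> coefs l' -> agree n g' f -> agree n l' f ->
      agree n0 g' f0 -> agree n0 l' f0 -> g' n = l' n -> P g' -> P l'.
    move=> g'S l'S g'f l'f g'f0 l'f0 e Pg'; apply: contrapT => nPl'.
    apply: hno; exists (g' n) => //; exists g', l'; split=> //; split.
      exact: agree_updS.
    by rewrite e; exact: agree_updS.
  pose Q s := exists m, [/\ coefs m, agree n m f, agree n0 m f0, m n = s & P m].
  have Qg : Q (g n) by exists g.
  have Qadj a b : a \in S -> b \in S -> a < b -> b <= a + 2 -> (Q a <-> Q b).
    move=> aS bS ab b2.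
    have [g' [l' [g'S l'S [g'g l'g] [<- <-] Pgl]]] := adj n g a b n0n gS gf0 aS bS ab b2.
    have g'f := agree_trans g'g gf; have l'f := agree_trans l'g gf.
    have g'f0 : agree n0 g' f0 := agree_trans (agree_leq n0n g'g) gf0.
    have l'f0 : agree n0 l' f0 := agree_trans (agree_leq n0n l'g) gf0.
    by split=> -[m [mS mf mf0 mn Pm]]; [exists l' | exists g']; split=> //;
      apply/Pgl; apply: pure Pm.
  have [m [mS mf mf0 mn Pm]] := chain Q Qadj _ _ (gS n) (lS n) Qg.
  by apply: nPl; apply: pure Pm.
- by exists f1, g1.
have fc : coefs f.
  move=> i; have [in0|] := ltnP i n0; last exact: fS.
  by rewrite ff0 // -f1f0.
have [n hn] := loc f fc ff0.
have [g [l [[gS lS] [gf lf] _ [Pg nPl]]]] := mf (maxn n n0) (leq_maxr _ _).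
apply: nPl; apply/(hn l lS (agree_leq (leq_maxl _ _) lf)).
exact/(hn g gS (agree_leq (leq_maxl _ _) gf)).
Qed.

End Words.

(** * Changing one coefficient without moving the roots *)

Section Bousch.
Local Open Scope complex_scope.
Variable R : realType.
Implicit Types (z : R[i]) (f g : nat -> R) (n k : nat).

Lemma psum_add (u : nat -> R[i]) m n z :
  psum u (m + n) z = psum u m z + z ^+ m * psum (fun i => u (m + i)%N) n z.
Proof.
elim: n => [|n IH]; first by rewrite addn0 /psum big_ord0 mulr0 addr0.
by rewrite addnS !psumS IH exprD; ring.
Qed.

(** The coefficients of [(f_0 + .. + f_(n-1) X^(n-1) + (a - t) X^n) / (1 - t X^n)],
for [f_0 = 1]. The constant term 1 makes the coefficient of index [n] equal to
[a], whatever [t] is. *)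
Definition geom_ext f n (a t : R) i :=
  if (i < n)%N then f i else
  if (i %% n == 0)%N then t ^+ (i %/ n).-1 * a else t ^+ (i %/ n) * f (i %% n)%N.

Lemma psum_geom_ext f n (a t : R) z N : (0 < n)%N -> f 0%N = 1 ->
  let q := t%:C * z ^+ n in
  psum (cseq (geom_ext f n a t)) (N.+1 * n) z =
    (\sum_(k < N) q ^+ k) * (psum (cseq f) n z + (a - t)%:C * z ^+ n)
    + q ^+ N * psum (cseq f) n z.
Proof.
move=> n0 f0 q; elim: N => [|N IH].
  rewrite mul1n big_ord0 mul0r add0r mul1r; apply: psum_ext => i hi.
  by rewrite /cseq /geom_ext hi.
rewrite mulSn addnC psum_add IH big_ord_recr /=.
set P := psum (cseq f) n z.
have -> : psum (fun i => cseq (geom_ext f n a t) (N.+1 * n + i)%N) n z =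
    t%:C ^+ N.+1 * P + (t%:C ^+ N * a%:C - t%:C ^+ N.+1).
  rewrite /P; case: n n0 {q IH P} => // n _.
  rewrite /psum !big_ord_recl expr0 !mulr1 addn0.
  rewrite {1}/cseq /geom_ext ltnNge leq_pmull //= modnMl eqxx mulnK //=.
  rewrite [cseq f 0]/cseq f0 rmorphM rmorphXn mulrDr mulr1.
  rewrite mulr_sumr (eq_bigr (fun i : 'I_n => t%:C ^+ N.+1 *
     (cseq f (lift ord0 i) * z ^+ lift ord0 i))); first by ring.
  move=> i _; rewrite mulrA; congr (_ * _).
  rewrite /cseq /geom_ext /bump add1n ltnNge.
  have hi : (i.+1 < n.+1)%N by rewrite ltnS.
  rewrite (leq_trans (leq_pmull _ _) (leq_addr _ _)) //=.
  rewrite modnMDl modn_small //= divnMDl // divn_small // addn0.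
  by rewrite rmorphM rmorphXn.
have -> : z ^+ (N.+1 * n) = z ^+ n * (z ^+ n) ^+ N by rewrite mulSn exprD mulnC exprM.
by rewrite rmorphB /q !exprMn !exprS; ring.
Qed.

(** The factor [1 / (1 - t X^n)] has neither zeros nor poles in the disc, so the
roots are those of the polynomial. *)
Lemma root_geom_ext f n (a t M : R) z : (0 < n)%N -> f 0%N = 1 ->
  (forall i, `|geom_ext f n a t i| <= M) -> `|t| <= 1 -> z != 0 -> normc z <= 1 / 4 ->
  root_of (geom_ext f n a t) z <-> psum (cseq f) n z + (a - t)%:C * z ^+ n = 0.
Proof.
move=> n0 f0 gM t1 z0 z4; set g := geom_ext f n a t; set P := psum (cseq f) n z.
set H := P + _; pose q := t%:C * z ^+ n.
have z1 : normc z < 1 by lra.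
have q4 : normc q <= 1 / 4.
  rewrite normcM normc_real normcX -[leRHS]mul1r ler_pM ?exprn_ge0 ?normc_ge0 //.
  by apply: le_trans z4; rewrite -[leRHS]expr1; apply: ler_wiXn2l;
    rewrite ?normc_ge0 // ltW.
have qN N : normc (q ^+ N) <= (1 / 4) ^+ N.
  by rewrite normcX lerXn2r ?nnegrE ?normc_ge0 //; lra.
have gM' i : normc (cseq g i) <= M by apply: cseq_bound.
have E N : psum (cseq g) (N.+1 * n) z = (\sum_(k < N) q ^+ k) * H + q ^+ N * P.
  exact: psum_geom_ext.
have [q0 q1] : 0 <= 1 / 4 :> R /\ 1 / 4 < 1 :> R by split; lra.
have NN N : (N < N.+1 * n)%N by rewrite (leq_trans _ (leq_pmulr _ n0)).
split=> [rg|H0]; last first.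
  apply: (series_root_of_psum gM') => // e e0 m.
  have P1 : 0 < normc P + 1 by rewrite ltr_wpDl ?normc_ge0.
  have [k hk] := exprn_small q0 q1 (divr_gt0 e0 P1).
  exists ((m + k).+1 * n)%N; first by apply: leq_trans (ltnW (NN _)); rewrite leq_addr.
  rewrite E H0 mulr0 add0r normcM.
  have h1 : normc (q ^+ (m + k)) <= (1 / 4) ^+ k.
    by apply: le_trans (qN _) _; apply: ler_wiXn2l; [|exact: ltW|rewrite leq_addl].
  move: hk; rewrite ltr_pdivlMr // => hk; apply: le_lt_trans hk.
  by rewrite ler_pM ?normc_ge0 // lerDl.
have geom N : 1 / 2 <= normc (\sum_(k < N.+1) q ^+ k).
  have e1 : (1 - q) * (\sum_(k < N.+1) q ^+ k) = 1 - q ^+ N.+1.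
    by rewrite -[1 - q]opprB mulNr -subrX1 opprB.
  have l1 := normcB_ge 1 (q ^+ N.+1); rewrite -e1 normcM normc1 in l1.
  have l2 := normcB_le 1 q; rewrite normc1 in l2.
  have l3 : normc (q ^+ N.+1) <= 1 / 4.
    rewrite exprS normcM -[leRHS]mulr1 ler_pM ?normc_ge0 //.
    by rewrite normcX exprn_ile1 ?normc_ge0 //; lra.
  have := normc_ge0 (\sum_(k < N.+1) q ^+ k); nra.
apply/eqP; rewrite -normc_eq0 eq_le normc_ge0 andbT.
have M0 : 0 <= M := le_trans (normr_ge0 _) (gM 0%N).
have z5 : 0 < 1 - normc z by lra.
apply: (@le0_of_geometric R (1 / 4) (2 * (M / (1 - normc z) + normc P)) _ 1) => //.
case=> // N _.
have := series_root_psum gM' z1 rg ((N.+2 * n).-1); rewrite prednK ?muln_gt0 ?n0 //.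
move=> h1.
have h2 : normc z ^+ (N.+2 * n) <= (1 / 4) ^+ N.+1.
  apply: (@le_trans _ _ (normc z ^+ N.+1)).
    apply: ler_wiXn2l; rewrite ?normc_ge0 //; first exact: ltW.
    by apply: ltnW; apply: NN.
  by rewrite lerXn2r ?nnegrE ?normc_ge0.
have h3 : M * normc z ^+ (N.+2 * n) / (1 - normc z) <= M / (1 - normc z) * (1 / 4) ^+ N.+1.
  by rewrite [leRHS]mulrAC ler_pM2r ?invr_gt0 // ler_wpM2l.
have h4 := normcB_ge ((\sum_(k < N.+1) q ^+ k) * H) (- (q ^+ N.+1 * P)).
rewrite opprK -E normc_opp !normcM in h4.
have h5 := ler_wpM2r (normc_ge0 P) (qN N.+1).
have h6 := ler_wpM2r (normc_ge0 H) (geom N).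
by have := le_trans h1 h3; lra.
Qed.

End Bousch.

(** * Nonreal roots near the origin *)

(** What the second half of the theorem uses of the digits, with
[r = 1 / (sqrt (M + 2) - 1)]. The annulus [r <= |z| < 1] is covered by greedy
expansions because of [radius_cover]; in the disc that it surrounds,
[radius_lead] forces the leading coefficient 1 or -1 on series with a nonreal root. *)
Record dense_digits (R : realType) (S : {fset R}) (M r : R) : Prop := DenseDigits {
  digit_le : forall s, s \in S -> `|s| <= M;
  digit0 : 0 \in S;
  digit1 : 1 \in S;
  digitN : forall s, s \in S -> - s \in S;
  digit_step : forall a b, a \in S -> b \in S -> a < b -> b <= a + 2 ->
    b = a + 1 \/ b = a + 2;
  digit_chain : forall Q : R -> Prop,
    (forall a b, a \in S -> b \in S -> a < b -> b <= a + 2 -> (Q a <-> Q b)) ->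
    forall a b, a \in S -> b \in S -> Q a -> Q b;
  digit_near : forall t, `|t| <= M + 1 -> exists2 s, s \in S & `|t - s| <= 1;
  digit_small : forall s, s \in S -> s != 0 -> `|s| < 2 -> s = 1 \/ s = - 1;
  radius_gt0 : 0 < r;
  radius_le : r <= 1 / 5;
  radius_lead : M * r ^+ 2 < 2 * (1 - r) ^+ 2;
  radius_cover : 1 + 2 * r = (M + 1) * r ^+ 2 }.

Section UpperRoots.
Local Open Scope complex_scope.
Variables (R : realType) (S : {fset R}) (M r : R).
Hypothesis SMr : dense_digits S M r.
Let SM := digit_le SMr.
Let S_1 := digit1 SMr.
Let SN := digitN SMr.
Let Sgap := digit_step SMr.
Let Schain := digit_chain SMr.
Let r_gt0 := radius_gt0 SMr.
Let r_le := radius_le SMr.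
Let Mr := ltW (radius_lead SMr).
Implicit Types (x z : R[i]) (f g : nat -> R) (n k : nat).

Let M1 : 1 <= M. Proof. by have := SM S_1; rewrite normr1. Qed.

Lemma coefs_le f : coefs S f -> forall i, `|f i| <= M.
Proof. by move=> fS i; apply: SM. Qed.

(** A square root, because [root_separation] bounds the product of the distances
to a root and to its conjugate. *)
Definition radius n : R := Num.sqrt (2 * (M + 1)) * Num.sqrt r ^+ n.

Lemma radius_sqr n : radius n ^+ 2 = 2 * (M + 1) * r ^+ n.
Proof.
rewrite /radius exprMn sqr_sqrtr; last by have := M1; lra.
by rewrite -exprM mulnC exprM sqr_sqrtr // ltW.
Qed.

Lemma radius_ge0 n : 0 <= radius n.
Proof. by rewrite mulr_ge0 ?exprn_ge0 ?sqrtr_ge0. Qed.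

Lemma radius_small (e : R) : 0 < e -> exists N, forall n, (N <= n)%N -> radius n < e.
Proof.
move=> e0; have s0 : 0 <= Num.sqrt r := sqrtr_ge0 r.
have s1 : Num.sqrt r < 1.
  rewrite -[ltRHS]sqrtr1 ltr_sqrt //; have := r_le; lra.
have c0 : 0 < Num.sqrt (2 * (M + 1)) by rewrite sqrtr_gt0; have := M1; lra.
have [N hN] := exprn_small s0 s1 (divr_gt0 e0 c0); exists N => n Nn.
move: hN; rewrite ltr_pdivlMr // mulrC => hN; apply: le_lt_trans hN.
by rewrite ler_wpM2l ?(ltW c0) //; apply: ler_wiXn2l => //; exact: ltW.
Qed.

(** In the closed upper half plane, [x] is at least as close to [z] as to the
conjugate of [z]. *)
Lemma upper_roots_close f g x z n :
  coefs S f -> coefs S g -> f 0%N = 1 -> agree n.+1 f g ->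
  normc x <= r -> 0 <= complex.Im x -> root_of f x ->
  normc z <= r -> 0 < complex.Im z -> root_of g z ->
  normc (x - z) <= radius n.+1.
Proof.
move=> fS gS f0 fg xr xi rx zr zi rz.
have g0 : g 0%N = 1 by rewrite -fg.
have zi0 : complex.Im z != 0 by rewrite gt_eqF.
have [fM gM] := (coefs_le fS, coefs_le gS).
have fg' i : (i <= n)%N -> f i = g i by move=> hi; apply: fg.
have h := root_separation fM gM r_gt0 r_le Mr g0 fg' xr rx zr zi0 rz.
rewrite -(@ler_pXn2r _ 2) ?nnegrE ?normc_ge0 ?radius_ge0 // radius_sqr.
apply: le_trans h; rewrite expr2 ler_wpM2l ?normc_ge0 //.
rewrite -(@ler_pXn2r _ 2) ?nnegrE ?normc_ge0 // !sqr_normcE.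
by move: xi zi; case: (x) => a b; case: (z) => c d /= xi zi; nra.
Qed.

Lemma upper_root_unique f x z : coefs S f -> f 0%N = 1 ->
  normc x <= r -> 0 <= complex.Im x -> root_of f x ->
  normc z <= r -> 0 < complex.Im z -> root_of f z -> x = z.
Proof.
move=> fS f0 xr xi rx zr zi rz; apply/eqP; rewrite -subr_eq0 -normc_eq0.
rewrite eq_le normc_ge0 andbT leNgt; apply/negP => /radius_small [N hN].
have := hN N.+1 (leqnSn _); apply/negP; rewrite -leNgt.
exact: (upper_roots_close fS fS f0 _ xr xi rx zr zi rz).
Qed.

Definition upper z := 0 < complex.Im z /\ normc z < r.

Definition cyl_root n f0 z :=
  upper z /\ exists f, [/\ coefs S f, agree n f f0 & root_of f z].

Lemma upper_open z : upper z ->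
  exists2 d : R, 0 < d & forall x, normc (x - z) < d -> upper x.
Proof.
move=> [zi zr]; have zr' : 0 < r - normc z by lra.
have [d d0 [d1 d2]] := pos_lower_bound zi zr'.
exists d => // x xd; split.
  have := normc_Im_le (x - z); rewrite raddfB /= => h.
  have := le_lt_trans h xd; rewrite ltr_norml => /andP[]; lra.
have := normcB_triangle z x 0; rewrite !subr0; lra.
Qed.

(** If [b = a + 1] then [a - 0 = b - 1], and if [b = a + 2] then
[a + 1 = b - 1]: in both cases [geom_ext] produces the letters [a] and [b] from
a single polynomial. The other coefficients are digits since the set of digits
is symmetric and contains 0. *)
Lemma letter_change f n a b : (0 < n)%N -> coefs S f -> f 0%N = 1 ->
  a \in S -> b \in S -> a < b -> b <= a + 2 ->
  exists g, exists l, [/\ coefs S g, coefs S l, agree n g f /\ agree n l f,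
    g n = a /\ l n = b &
    forall z, z != 0 -> normc z <= 1 / 4 -> (root_of g z <-> root_of l z)].
Proof.
move=> n0 fS f0 aS bS ab b2.
have ext_coefs c t : c \in S -> t \in [:: 0; 1; -1] -> coefs S (geom_ext f n c t).
  move=> cS ht; have tX k s : s \in S -> t ^+ k * s \in S.
    move=> sS; elim: k => [|k IH]; first by rewrite expr0 mul1r.
    rewrite exprS -mulrA; move: ht; rewrite !inE => /or3P[] /eqP e; rewrite {1}e.
    - by rewrite mul0r (digit0 SMr).
    - by rewrite mul1r.
    - by rewrite mulN1r SN.
  by move=> i; rewrite /geom_ext; case: ifP => _ //; case: ifP => _; apply: tX.
have ext_agree c t : agree n (geom_ext f n c t) f.
  by move=> i hi; rewrite /geom_ext hi.
have ext_n c t : geom_ext f n c t n = c.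
  by rewrite /geom_ext ltnn modnn eqxx divnn n0 expr0 mul1r.
have eqv (s t : R) : s \in [:: 0; 1; -1] -> t \in [:: 0; 1; -1] -> a - s = b - t ->
    exists g, exists l, [/\ coefs S g, coefs S l, agree n g f /\ agree n l f,
    g n = a /\ l n = b &
    forall z, z != 0 -> normc z <= 1 / 4 -> (root_of g z <-> root_of l z)].
  move=> hs ht e; exists (geom_ext f n a s), (geom_ext f n b t).
  have le1 u : u \in [:: 0; 1; -1] -> `|u| <= 1 :> R.
    by rewrite !inE => /or3P[] /eqP ->; rewrite ?normrN ?normr0 ?normr1.
  split; [exact: ext_coefs|exact: ext_coefs|by []|by []|move=> z z0 z4].
  have h1 := root_geom_ext n0 f0 (coefs_le (ext_coefs a s aS hs)) (le1 _ hs) z0 z4.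
  have h2 := root_geom_ext n0 f0 (coefs_le (ext_coefs b t bS ht)) (le1 _ ht) z0 z4.
  by rewrite h1 h2 e.
have [e|e] := Sgap aS bS ab b2.
- by apply: (eqv 0 1); rewrite ?inE ?eqxx ?orbT // e; lra.
- by apply: (eqv (-1) 1); rewrite ?inE ?eqxx ?orbT // e; lra.
Qed.

(** A clopen part [K] of the upper roots met by one series of the cylinder is
met by all of them: having a root in [K] is a locally constant property of
the series, by stability of simple roots, and it is insensitive to the choice
of the next coefficient, by [letter_change]. *)
Lemma clopen_roots_all n0 f0 (K : R[i] -> Prop) : (0 < n0)%N -> f0 0%N = 1 ->
  (forall z, K z -> cyl_root n0 f0 z) ->
  (forall z, (forall d : R, 0 < d -> exists2 x, K x & normc (x - z) < d) -> K z) ->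
  (forall z, K z -> exists2 d : R, 0 < d &
     forall x, cyl_root n0 f0 x -> normc (x - z) < d -> K x) ->
  (exists z, K z) ->
  forall f, coefs S f -> agree n0 f f0 -> exists2 z, K z & root_of f z.
Proof.
move=> n0_gt0 f00 KZ Kcl Kop [z0 Kz0] f fS ff0.
have lead g : agree n0 g f0 -> g 0%N = 1 by move=> h; rewrite h.
have Kr z : K z -> [/\ 0 < complex.Im z, normc z <= r & normc z <= 1 / 4].
  by move=> /KZ [[zi zr] _]; split=> //; [exact: ltW | have := r_le; lra].
have [_ [g0 [g0S g0f0 g0z]]] := KZ _ Kz0.
pose P g := exists2 z, K z & root_of g z.
apply: (@cylinder_constant R S P n0 f0 Schain _ _ g0 f) => //; last by exists z0.
- move=> n g a b n0n gS gf0 aS bS ab b2.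
  have [g1 [g2 [g1S g2S ag ab' eqv]]] :=
    letter_change (leq_trans n0_gt0 n0n) gS (lead _ gf0) aS bS ab b2.
  exists g1, g2; split=> //.
  by split=> -[z Kz rz]; exists z => //; have [_ _ z4] := Kr _ Kz; apply/(eqv z rz.1 z4).
- move=> g gS gf0; have gM := coefs_le gS; have gl := lead _ gf0.
  have [[z Kz rz]|nP] := pselect (P g).
    have [zi zr z4] := Kr _ Kz; have zi0 : complex.Im z != 0 by rewrite gt_eqF.
    have [d d0 hd] := Kop _ Kz; have [e e0 he] := upper_open (KZ _ Kz).1.
    have [s s0 [sd se]] := pos_lower_bound d0 e0.
    have [n hn] := root_perturb gM gl r_gt0 r_le Mr zr zi0 rz s0.
    exists (maxn n n0) => l lS lg; split=> _; first by exists z.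
    have [x xz rx] := hn l (coefs_le lS) (agree_leq (leq_maxl _ _) lg).
    exists x => //; apply: hd; last exact: lt_trans sd.
    split; first by apply: he; exact: lt_trans se.
    exists l; split=> //; apply: agree_trans gf0.
    exact: agree_leq (leq_maxr _ _) lg.
  apply: contrapT => hno.
  have /choice [zg hzg] : forall n, exists zg : R[i] * (nat -> R),
      [/\ coefs S zg.2, agree n.+1 zg.2 g, K zg.1 & root_of zg.2 zg.1].
    move=> n; apply: contrapT => hn; apply: hno; exists n.+1 => l lS lg.
    split=> // -[z Kz rz]; case: hn; by exists (z, l).
  pose z n := (zg n).1; pose l n := (zg n).2.
  have hz n : [/\ coefs S (l n), agree n.+1 (l n) g, K (z n) & root_of (l n) (z n)].
    exact: hzg.
  have cauchy n m : (n <= m)%N -> normc (z n - z m) <= radius n.+1.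
    move=> nm; have [l1 l2 l3 l4] := hz n; have [m1 m2 m3 m4] := hz m.
    have [zi zr _] := Kr _ l3; have [wi wr _] := Kr _ m3.
    apply: (upper_roots_close l1 m1 _ _ zr (ltW zi) l4 wr wi m4).
      by rewrite l2 // lead.
    by apply: agree_trans l2 (agree_sym (agree_leq _ m2)).
  have [w hw] := complex_cauchy_limit cauchy.
  have near (d : R) : 0 < d -> exists N, forall n, (N <= n)%N -> normc (z n - w) < d.
    move=> d0; have [N hN] := radius_small (divr_gt0 d0 (ltr0n _ 2)).
    exists N => n Nn; apply: le_lt_trans (hw n) _.
    by have := hN n.+1 (leqW Nn); lra.
  have Kw : K w.
    apply: Kcl => d d0; have [N hN] := near d d0.
    by exists (z N); [case: (hz N) | exact: hN].
  apply: nP; exists w => //.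
  have r1 : r < 1 by have := r_le; lra.
  have [_ wr _] := Kr _ Kw.
  apply: (root_limit gM _ (ltW r_gt0) r1 (le_lt_trans wr r1)).
    by rewrite gl normr1.
  move=> n d d0; have [N hN] := near d d0.
  have [h1 h2 h3 h4] := hz (maxn N n); exists (z (maxn N n)), (l (maxn N n)); split=> //.
  - by case: (Kr _ h3).
  - by apply: hN; rewrite leq_maxl.
  - exact: coefs_le.
  - by apply: agree_leq h2; rewrite leqW // leq_maxr.
Qed.

End UpperRoots.

(** * Connectedness in the complex plane *)

Section Topology.
Local Open Scope complex_scope.
Variable R : realType.
Implicit Types (x y z : R[i]) (A B : set R[i]).

Lemma normE z : `|z| = (normc z)%:C.
Proof. by []. Qed.

Lemma nbhs_normcP z A :
  nbhs z A <-> exists2 d : R, 0 < d & forall x, normc (x - z) < d -> A x.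
Proof.
split=> [/nbhs_ballP [e /= e0 he]|[d d0 hd]].
  have [e1 e2] : 0 < complex.Re e /\ e = (complex.Re e)%:C.
    by move: e0; case: (e) => a b; rewrite ltcE /= => /andP[/eqP -> ?].
  exists (complex.Re e) => // x xd; apply: he; rewrite -ball_normE /=.
  by rewrite normE e2 ltcR normcBC.
apply/nbhs_ballP; exists d%:C; first by rewrite /= ltcR.
by move=> x; rewrite -ball_normE /= normE ltcR normcBC => /hd.
Qed.

Lemma open_normcP A :
  open A <-> forall z, A z -> exists2 d : R, 0 < d & forall x, normc (x - z) < d -> A x.
Proof.
rewrite openE; split=> h z Az; first exact/nbhs_normcP/h.
exact/nbhs_normcP/h.
Qed.

Lemma closed_normcP A :
  closed A <-> forall z, (forall d : R, 0 < d -> exists2 x, A x & normc (x - z) < d) -> A z.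
Proof.
split=> h z.
  move=> hz; apply: h => B /nbhs_normcP [d d0 hd].
  by have [x Ax xd] := hz d d0; exists x; split=> //; apply: hd.
move=> cz; apply: h => d d0.
have : nbhs z [set x | normc (x - z) < d] by apply/nbhs_normcP; exists d.
by move=> /cz [x [Ax xd]]; exists x.
Qed.

Lemma continuous_to_complex (T : topologicalType) (F : T -> R[i]) t :
  (forall d : R, 0 < d -> \forall s \near t, normc (F s - F t) < d) ->
  {for t, continuous F}.
Proof.
move=> h B /nbhs_normcP [d d0 hd]; have := h d d0.
by apply: filterS => s; apply: hd.
Qed.

Definition csegment x y : set R[i] := [set x + t%:C * (y - x) | t in `[0, 1]].

Lemma csegment_connected x y : connected (csegment x y).
Proof.
apply: connected_continuous_connected; first exact: segment_connected.
apply: continuous_subspaceT => t; apply: continuous_to_complex => d d0.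
have e0 : 0 < d / (normc (y - x) + 1) by rewrite divr_gt0 // ltr_wpDl ?normc_ge0.
near=> s.
have -> : x + s%:C * (y - x) - (x + t%:C * (y - x)) = (s - t)%:C * (y - x).
  by rewrite rmorphB; ring.
rewrite normcM normc_real.
have : ball t (d / (normc (y - x) + 1)) s by near: s; apply: nbhsx_ballx.
rewrite -ball_normE /= distrC ltr_pdivlMr ?ltr_wpDl ?normc_ge0 //.
by apply: le_lt_trans; rewrite ler_wpM2l // lerDl.
Unshelve. all: by end_near. Qed.

Definition joined A x y := exists W, [/\ connected W, W `<=` A, W x & W y].

Lemma joined_segment A x y :
  (forall t : R, 0 <= t -> t <= 1 -> A (x + t%:C * (y - x))) -> joined A x y.
Proof.
move=> h; exists (csegment x y); split; first exact: csegment_connected.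
- by move=> _ [t /= + <-]; rewrite in_itv /= => /andP[? ?]; apply: h.
- by exists 0; rewrite ?mul0r ?addr0 //= in_itv /= lexx ler01.
- by exists 1; rewrite ?mul1r ?subrKC //= in_itv /= ler01 lexx.
Qed.

Lemma joined_sym A x y : joined A x y -> joined A y x.
Proof. by move=> [W [*]]; exists W. Qed.

Lemma joined_trans A y x z : joined A x y -> joined A y z -> joined A x z.
Proof.
move=> [V [cV VA Vx Vy]] [W [cW WA Wy Wz]]; exists (V `|` W); split.
- by apply: connectedU => //; exists y.
- by move=> t [/VA|/WA].
- by left.
- by right.
Qed.

Lemma joined_sub A B x y : A `<=` B -> joined A x y -> joined B x y.
Proof. by move=> AB [W [? WA ? ?]]; exists W; split=> // t /WA /AB. Qed.

Lemma joined_in A x y : joined A x y -> A y.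
Proof. by move=> [W [_ WA _ Wy]]; apply: WA. Qed.

Lemma connected_of_joined A x : (forall y, A y -> joined A x y) -> connected A.
Proof.
move=> h; pose I := [set W | [/\ connected W, W `<=` A & W x]].
have -> : A = \bigcup_(W in I) W.
  apply/seteqP; split=> [y /h [W [? ? ? ?]]|y [W [_ WA _] Wy]]; last exact: WA.
  by exists W.
by apply: bigcup_connected => [|W []//]; exists x => W [].
Qed.

Definition clopen_in A (K O F : set R[i]) :=
  [/\ open O, closed F, K = A `&` O & K = A `&` F].

(** By complementation it suffices to exclude the clopen parts that miss [x]. *)
Lemma connected_from_point A x :
  (forall K O F, clopen_in A K O F -> ~ K x -> forall z, ~ K z) -> A x ->
  connected A.
Proof.
move=> h Ax B [b Bb] [U oU BU] [F cF BF].
have Bx : B x.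
  by apply: contrapT => nBx; apply: (h B U F _ nBx b).
have compl : clopen_in A (A `&` ~` B) (~` F) (~` U).
  split; [exact: closed_openC | exact: open_closedC | rewrite {1}BF | rewrite {1}BU];
    by apply/seteqP; split=> z [Az nz]; split=> // nB; apply: nz; [split| case: nB].
apply/seteqP; split=> [z|z Az]; first by rewrite BU => -[].
apply: contrapT => nBz; apply: (h _ _ _ compl _ z); last by split.
by case.
Qed.

Lemma joined_clopen A K O F x y : clopen_in A K O F -> joined A x y -> K x -> K y.
Proof.
move=> [oO cF KO KF] [W [cW WA Wx Wy]] Kx.
have : W `&` K = W.
  apply: cW; first by exists x.
  - exists O => //; rewrite KO setIA; congr (_ `&` _).
    by apply/seteqP; split=> z; [case | move=> Wz; split=> //; exact: WA].
  - exists F => //; rewrite KF setIA; congr (_ `&` _).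
    by apply/seteqP; split=> z; [case | move=> Wz; split=> //; exact: WA].
by move=> e; move: Wy; rewrite -e => -[].
Qed.

Definition cball z (d : R) : set R[i] := [set x | normc (x - z) < d].

Lemma open_cball z d : open (cball z d).
Proof.
apply/open_normcP => x xd; have e0 : 0 < d - normc (x - z) by rewrite subr_gt0.
exists (d - normc (x - z)) => // y yx.
by have := normcB_triangle x y z; rewrite /cball /=; lra.
Qed.

(** Local connectedness only asks for neighbourhoods that are joined to the
centre inside a given ball: the component of [z] in [A `&` U] is then open. *)
Lemma locally_connected_of_joined A :
  (forall z (e : R), A z -> 0 < e -> exists2 d : R, 0 < d &
     forall x, A x -> normc (x - z) < d -> joined (A `&` cball z e) z x) ->
  locally_connected A.
Proof.
move=> h z U Az oU Uz.
pose C : set R[i] := [set y | joined (A `&` U) z y].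
have Cz : C z.
  exists [set z]; split=> //; first exact: connected1.
  by move=> _ ->.
have near y : C y -> exists2 d : R, 0 < d & forall x, A x -> normc (x - y) < d -> C x.
  move=> Cy; have [Ay Uy] := joined_in Cy.
  have [e e0 he] := (open_normcP U).1 oU y Uy.
  have [d d0 hd] := h y e Ay e0; exists d => // x Ax xy.
  apply: joined_trans Cy _; apply: joined_sub (hd x Ax xy).
  by move=> t [At /he].
pose V : set R[i] := [set x | exists y d, [/\ C y, forall t, A t -> normc (t - y) < d -> C t
  & normc (x - y) < d]].
have AV : A `&` V = C.
  apply/seteqP; split=> [x [Ax [y [d [_ hd xd]]]]|x Cx]; first exact: hd.
  split; first by case: (joined_in Cx).
  by have [d d0 hd] := near x Cx; exists x, d; rewrite subrr normc0.
exists V; split.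
- apply/open_normcP => x [y [d [Cy hd xd]]].
  have [e e0 he] := (open_normcP _).1 (@open_cball y d) x xd.
  by exists e => // t /he td; exists y, d.
- by have [] : (A `&` V) z by rewrite AV; exact: Cz.
- by rewrite AV => x /joined_in.
- rewrite AV; apply: (@connected_of_joined _ z) => y [W [cW WA Wz Wy]].
  exists W; split=> // t Wt; exists W; split=> //.
Qed.

End Topology.

(** * Sigma as a set of roots *)

Section SigmaRoots.
Local Open Scope complex_scope.
Variables (R : realType) (S : {fset R}) (M : R).
Hypothesis SM : forall s, s \in S -> `|s| <= M.

Lemma SigmaP (z : R[i]) : Sigma (set_of_reals S) z <->
  normc z < 1 /\ exists f : nat -> R, [/\ coefs S f, f 0%N != 0 & root_of f z].
Proof.
have disc : unit_disc z <-> normc z < 1.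
  by rewrite /unit_disc /= normE -[1 in X in X <-> _]/(1%:C) ltcR.
have psumE (p : nat -> R[i]) : series (fun j => p j * z ^+ j) = (fun n => psum p n z).
  by apply/funext => n; rewrite /series /= big_mkord.
split=> [[/disc z1 [p [pS p0 pz]]]|[z1 [f [fS f0 fz]]]].
  have /choice [f hf] : forall j, exists s, s \in S /\ p j = s%:C.
    by move=> j; have [s sS <-] := pS j; exists s.
  have pf : p = cseq f by apply/funext => j; case: (hf j).
  split=> //; exists f; split=> [j||]; first by case: (hf j).
    by apply: contra p0 => /eqP e; rewrite pf /cseq e.
  have fM i : normc (cseq f i) <= M.
    by apply: cseq_bound; apply: SM; case: (hf i).
  have conv (e : R) : 0 < e -> forall N, exists2 m, (N <= m)%N & normc (psum (cseq f) m z) < e.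
    move=> e0 N; move: pz; rewrite psumE pf => /cvgrPdist_lt.
    have e0' : 0 < e%:C by rewrite ltcR.
    move=> /(_ _ e0') [N' _ hN']; exists (maxn N N'); first exact: leq_maxl.
    by have := hN' (maxn N N') (leq_maxr _ _); rewrite /= sub0r normrN normE ltcR.
  have z0 : z != 0.
    apply/eqP => z0; have e0 : 0 < normc (p 0%N) by rewrite normc_gt0.
    have [[//|m] _] := conv _ e0 1%N.
    rewrite z0 /psum big_ord_recl big1 => [|i _]; last by rewrite expr0n mulr0.
    by rewrite expr0 mulr1 addr0 -pf ltxx.
  exact: series_root_of_psum fM z0 z1 conv.
split; first exact/disc.
exists (cseq f); split=> [j||].
- by exists (f j) => //=; exact: fS.
- by apply: contra f0 => /eqP [->].
rewrite psumE; apply/cvgrPdist_lt => e e0.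
have [e1 e2] : 0 < complex.Re e /\ e = (complex.Re e)%:C.
  by move: e0; case: (e) => a b; rewrite ltcE /= => /andP[/eqP -> ?].
have fM i : normc (cseq f i) <= M by apply: cseq_bound; apply: SM.
have M0 : 0 <= M := le_trans (normc_ge0 _) (fM 0%N).
have p0 : 0 < complex.Re e * (1 - normc z) / (M + 1).
  by apply: divr_gt0; [apply: mulr_gt0|]; lra.
have [k hk] := exprn_small (normc_ge0 z) z1 p0.
exists k.+1 => // -[//|n] /= kn; rewrite sub0r normrN normE e2 ltcR.
apply: le_lt_trans (series_root_psum fM z1 fz n) _.
rewrite ltr_pdivrMr; last lra.
have : normc z ^+ n.+1 <= normc z ^+ k.
  by apply: ler_wiXn2l; [exact: normc_ge0|exact: ltW|exact: ltnW].
move: hk; rewrite ltr_pdivlMr; last lra.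
have := exprn_ge0 n.+1 (normc_ge0 z); nra.
Qed.

End SigmaRoots.

(** * Greedy expansions *)

Section Covering.
Local Open Scope complex_scope.
Variables (R : realType) (S : {fset R}) (M : R).
Hypothesis SM : forall s, s \in S -> `|s| <= M.
Hypothesis SN : forall s, s \in S -> - s \in S.
Hypothesis S_1 : 1 \in S.
Hypothesis near : forall t, `|t| <= M + 1 -> exists2 s, s \in S & `|t - s| <= 1.
Implicit Types (x z b : R[i]) (f g : nat -> R).

Let nearest : exists pick : R -> R, forall t, `|t| <= M + 1 ->
  pick t \in S /\ `|t - pick t| <= 1.
Proof.
suff /choice [pick hp] : forall t, exists s, `|t| <= M + 1 -> s \in S /\ `|t - s| <= 1.
  by exists pick.
move=> t; have [h|h] := leP `|t| (M + 1); last by exists 0.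
by have [s sS ts] := near h; exists s.
Qed.

(** Greedy expansion: the quotient of the series by [1 - X / x] is kept in
[-1, 1]. *)
Lemma real_in_Sigma (x : R) : `|x| < 1 -> 1 / (M + 1) <= `|x| ->
  Sigma (set_of_reals S) x%:C.
Proof.
move=> x1 xM; have M1 : 1 <= M by have := SM S_1; rewrite normr1.
have x0 : 0 < `|x| by apply: lt_le_trans xM; apply: divr_gt0; lra.
have [pick hp] := nearest.
pose b := x^-1.
have bM : `|b| <= M + 1.
  have m0 : 0 < 1 / (M + 1) by apply: divr_gt0; lra.
  by rewrite normfV -[M + 1]invrK -[X in _ <= X^-1]div1r lef_pV2.
pose t := fix t n : R := if n is m.+1 then b * t m - pick (b * t m) else 1.
pose f n : R := if n is m.+1 then - pick (b * t m) else 1.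
have t1 n : `|t n| <= 1 /\ `|b * t n| <= M + 1.
  suff h : `|t n| <= 1.
    split=> //; rewrite normrM -[leRHS]mulr1 ler_pM //.
  elim: n => [|n IH] /=; first by rewrite normr1.
  by apply: (hp _ _).2; rewrite normrM -[leRHS]mulr1 ler_pM.
apply/(SigmaP SM); rewrite normc_real; split=> //.
exists f; split=> [[|n] //=||]; first by apply: SN; apply: (hp _ _).1; case: (t1 n).
  by rewrite oner_eq0.
split; first by rewrite -normc_eq0 normc_real gt_eqF.
exists 1 => n; have -> : divlin (x%:C)^-1 (cseq f) n = (t n)%:C.
  elim: n => [//|n IH].
  have -> : divlin (x%:C)^-1 (cseq f) n.+1 =
    (x%:C)^-1 * divlin (x%:C)^-1 (cseq f) n + (f n.+1)%:C by [].
  by rewrite IH -fmorphV -/b -rmorphM -rmorphD.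
by rewrite normc_real; case: (t1 n).
Qed.

(** The same for the quotient by the real quadratic polynomial with roots [z]
and its conjugate. *)
Lemma complex_in_Sigma z : z != 0 -> normc z < 1 ->
  normc z^-1 ^+ 2 + 2 * `|complex.Re z^-1| <= M + 1 ->
  Sigma (set_of_reals S) z.
Proof.
move=> z0 z1 hz; have [pick hp] := nearest.
pose b := z^-1; pose c := complex.Re b; pose N := normc b ^+ 2.
pose v (s : R * R) := 2 * c * s.2 - N * s.1.
pose st := fix st n : R * R :=
  if n is m.+1 then ((st m).2, v (st m) - pick (v (st m))) else (0, 1).
pose f n : R := if n is m.+1 then - pick (v (st m)) else 1.
have N0 : 0 <= N by rewrite sqr_ge0.
have vM s : `|s.1| <= 1 -> `|s.2| <= 1 -> `|v s| <= M + 1.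
  move=> h1 h2.
  have a1 : `|2 * c * s.2| <= 2 * `|c|.
    by rewrite normrM normrM ger0_norm // ler_piMr // mulr_ge0.
  have a2 : `|N * s.1| <= N by rewrite normrM ger0_norm // ler_piMr.
  by have := ler_normB (2 * c * s.2) (N * s.1); rewrite -/(v s) -/c -/b -/N in hz *; lra.
have st1 n : `|(st n).1| <= 1 /\ `|(st n).2| <= 1.
  elim: n => [|n [h1 h2]] /=; first by rewrite normr0 normr1 ler01.
  by split=> //; apply: (hp _ _).2; apply: vM.
apply/(SigmaP SM); split=> //; exists f; split=> [[|n] //=||].
- by apply: SN; apply: (hp _ _).1; apply: vM; case: (st1 n).
- by rewrite oner_eq0.
split=> //; exists (1 + normc b) => n.
have -> : divlin z^-1 (cseq f) n = ((st n).2)%:C - b^* * ((st n).1)%:C.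
  elim: n => [|n IH]; first by rewrite /= mulr0 subr0.
  have -> : divlin z^-1 (cseq f) n.+1 = b * divlin z^-1 (cseq f) n + (f n.+1)%:C by [].
  have bN : b * b^* = N%:C.
    by rewrite /N sqr_normcE; case: (b) => p q; apply/eqP; rewrite eq_complex /=;
      apply/andP; split; apply/eqP; ring.
  have bc : b + b^* = (2 * c)%:C.
    by rewrite /c; case: (b) => p q; apply/eqP; rewrite eq_complex /=;
      apply/andP; split; apply/eqP; ring.
  have vE : (v (st n))%:C = (b + b^*) * ((st n).2)%:C - b * b^* * ((st n).1)%:C.
    by rewrite bN bc -!rmorphM -rmorphB.
  have -> : (st n.+1).2 = v (st n) - pick (v (st n)) by [].
  have -> : (st n.+1).1 = (st n).2 by [].
  have -> : f n.+1 = - pick (v (st n)) by [].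
  have -> : (v (st n) - pick (v (st n)))%:C = (v (st n))%:C - (pick (v (st n)))%:C.
    exact: rmorphB.
  have -> : (- pick (v (st n)))%:C = - (pick (v (st n)))%:C by exact: rmorphN.
  by rewrite IH vE; ring.
apply: le_trans (normcB_le _ _) _; rewrite normcM normc_conj !normc_real.
by case: (st1 n) => h1 h2; rewrite lerD // ler_piMr ?normc_ge0.
Qed.

End Covering.

(** * The skeleton of Sigma *)

Section Skeleton.
Local Open Scope complex_scope.
Variables (R : realType) (S : {fset R}) (M r : R).
Hypothesis SMr : dense_digits S M r.
Let SM := digit_le SMr.
Let r_gt0 := radius_gt0 SMr.
Let r_le := radius_le SMr.
Let r_lt1 : r < 1. Proof. by have := r_le; lra. Qed.
Let M1 : 1 <= M. Proof. by have := SM (digit1 SMr); rewrite normr1. Qed.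
Implicit Types (x z w : R[i]) (f g : nat -> R) (n : nat).

Notation SigmaS := (Sigma (set_of_reals S)).

(** All of Sigma except its nonreal points of modulus less than [r]: see
[skeleton_sub] and [Sigma_cases]. *)
Definition skeleton : set R[i] := [set z | normc z < 1 /\
  (r <= normc z \/ complex.Im z = 0 /\ 1 / (M + 1) <= normc z)].

Lemma realE z : complex.Im z = 0 -> z = (complex.Re z)%:C.
Proof. by case: z => a b /= ->. Qed.

Lemma skeleton_sub : skeleton `<=` SigmaS.
Proof.
move=> z [z1 [zr|[zi zM]]]; last first.
  have e := realE zi; rewrite e in z1 zM *; rewrite normc_real in z1 zM.
  exact: real_in_Sigma SM (digitN SMr) (digit1 SMr) (digit_near SMr) _ z1 zM.
have z0 : z != 0 by rewrite -normc_gt0 (lt_le_trans r_gt0).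
apply: (complex_in_Sigma SM (digitN SMr) (digit1 SMr) (digit_near SMr) z0 z1).
have h1 : normc z^-1 <= r^-1 by rewrite normcV lef_pV2 ?posrE // normc_gt0.
have h2 := normc_Re_le z^-1; have h3 := normc_ge0 z^-1.
have -> : M + 1 = r^-1 ^+ 2 + 2 * r^-1.
  apply: (@mulIf _ (r ^+ 2)); first by rewrite expf_neq0 // lt0r_neq0.
  rewrite -(radius_cover SMr); field; exact: lt0r_neq0.
have : normc z^-1 ^+ 2 <= r^-1 ^+ 2.
  by rewrite lerXn2r ?nnegrE // invr_ge0 ltW.
lra.
Qed.

Lemma Sigma_conj z : SigmaS z -> SigmaS z^*.
Proof.
move=> /(SigmaP SM) [z1 [f [fS f0 fz]]]; apply/(SigmaP SM); rewrite normc_conj.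
by split=> //; exists f; split=> //; exact: root_conj.
Qed.

Lemma Sigma_real_ge z : SigmaS z -> 1 / (M + 1) <= normc z.
Proof.
move=> /(SigmaP SM) [z1 [f [fS f0 fz]]].
have n0 : 0 < normc z by rewrite normc_gt0 fz.1.
have := root_lead (coefs_le SMr fS) n0 z1 (lexx _) fz.
have : 1 <= `|f 0%N|.
  rewrite leNgt; apply/negP => h.
  have h2 : `|f 0%N| < 2 by lra.
  by have [e|e] := digit_small SMr (fS 0%N) f0 h2; move: h;
    rewrite e ?normrN normr1 ltxx.
move=> h1 h2; have := le_trans h1 h2.
by rewrite ler_pdivlMr ?subr_gt0 // ler_pdivrMr; have := M1; lra.
Qed.

Lemma Sigma_cases z : SigmaS z ->
  skeleton z \/ [/\ complex.Im z != 0, normc z < r &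
    exists f, [/\ coefs S f, f 0%N = 1 & root_of f z]].
Proof.
move=> Sz; have zM := Sigma_real_ge Sz; have /(SigmaP SM) [z1 [f [fS f0 fz]]] := Sz.
have [zr|zr] := leP r (normc z); first by left; split=> //; left.
have [zi|zi] := eqVneq (complex.Im z) 0; first by left; split=> //; right.
right; split=> //.
have := nonreal_root_lead (coefs_le SMr fS) r_gt0 r_lt1 (ltW zr) zi fz.
rewrite ler_pdivlMr ?exprn_gt0 ?subr_gt0 // => h.
have f2 : `|f 0%N| < 2.
  have p : 0 < (1 - r) ^+ 2 by rewrite exprn_gt0 ?subr_gt0.
  by rewrite -(ltr_pM2r p) (le_lt_trans h) // (radius_lead SMr).
have [e|e] := digit_small SMr (fS 0%N) f0 f2; first by exists f.
exists (fun i => - f i); split=> [i||]; last exact: rootN.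
  exact: digitN SMr _ (fS i).
by rewrite e opprK.
Qed.

Lemma upper_nonskeleton z : complex.Im z != 0 -> normc z < r -> ~ skeleton z.
Proof. by move=> zi zr [_ [|[/eqP]]]; [rewrite leNgt zr | rewrite (negbTE zi)]. Qed.

(** A chord of the circle of radius 1/2 seen from 0 under at most a right angle
stays at distance at least [1 / sqrt 8 > 1 / 5] from 0. *)
Lemma chord_in_skeleton x y : normc x = 1 / 2 -> normc y = 1 / 2 ->
  0 <= complex.Re x * complex.Re y + complex.Im x * complex.Im y ->
  joined skeleton x y.
Proof.
move=> x2 y2 xy; apply: joined_segment => t t0 t1; split.
  have -> : x + t%:C * (y - x) = (1 - t)%:C * x + t%:C * y by rewrite rmorphB; ring.
  apply: le_lt_trans (normc_leD _ _) _; rewrite !normcM !normc_real x2 y2.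
  by rewrite !ger0_norm //; lra.
left; rewrite -(@ler_pXn2r _ 2) ?nnegrE ?normc_ge0 ?(ltW r_gt0) //.
have r2 : r ^+ 2 <= 1 / 25 by rewrite expr2; have := r_gt0; have := r_le; nra.
apply: le_trans r2 _.
have := sqr_normcE x; have := sqr_normcE y; rewrite x2 y2 sqr_normcE.
move: xy; case: (x) => a b; case: (y) => c d /= h1 h2 h3.
rewrite !mul0r !subr0 !addr0.
have e : (a + t * (c - a)) ^+ 2 + (b + t * (d - b)) ^+ 2 =
  (1 - t) ^+ 2 * (a ^+ 2 + b ^+ 2) + t ^+ 2 * (c ^+ 2 + d ^+ 2) +
  2 * (t * (1 - t)) * (a * c + b * d) by ring.
rewrite e -h2 -h3.
have : 0 <= 2 * (t * (1 - t)) * (a * c + b * d).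
  by apply: mulr_ge0 => //; apply: mulr_ge0 => //; apply: mulr_ge0; lra.
by have := sqr_ge0 (t - 1 / 2); rewrite !expr2; lra.
Qed.

Definition basepoint : R[i] := (1 / 2 : R)%:C.

Lemma skeleton_basepoint : skeleton basepoint.
Proof.
have := r_le; split; rewrite normc_real ger0_norm; lra.
Qed.

(** Go radially to the circle of radius 1/2, then along chords through [i / 2] or
[- i / 2]. *)
Lemma skeleton_joined z : skeleton z -> joined skeleton basepoint z.
Proof.
move=> zs; have [z1 zr] := zs.
have n0 : 0 < normc z.
  by case: zr => [|[_]] h; apply: lt_le_trans h => //; apply: divr_gt0; have := M1; lra.
pose w := (2 * normc z)^-1%:C * z.
have w2 : normc w = 1 / 2.
  rewrite normcM normc_real ger0_norm; first by field; exact: lt0r_neq0.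
  by rewrite invr_ge0 mulr_ge0 // ltW.
have wz : joined skeleton w z.
  apply: joined_segment => t t0 t1.
  have -> : w + t%:C * (z - w) = ((1 - t) * (2 * normc z)^-1 + t)%:C * z.
    by rewrite /w rmorphD rmorphM rmorphB; ring.
  set k := (1 - t) * (2 * normc z)^-1 + t.
  have nk : k * normc z = (1 - t) / 2 + t * normc z.
    by rewrite /k; field; exact: lt0r_neq0.
  have k0 : 0 <= k.
    by rewrite addr_ge0 // mulr_ge0 ?subr_ge0 // invr_ge0 mulr_ge0 // ltW.
  have nkz : normc (k%:C * z) = (1 - t) / 2 + t * normc z.
    by rewrite normcM normc_real ger0_norm.
  split; first by rewrite nkz; nra.
  case: zr => [zr|[zi zr]]; first by left; rewrite nkz; have := r_le; nra.
  right; split; first by case: (z) zi => a b /= ->; rewrite !mul0r mulr0 addr0.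
  have : 1 / (M + 1) <= 1 / 2.
    by rewrite !div1r lef_pV2 ?posrE; have := M1; lra.
  by rewrite nkz; nra.
have [i1 i2] : normc (0 +i* (1 / 2) : R[i]) = 1 / 2 /\ normc (0 +i* (- (1 / 2)) : R[i]) = 1 / 2.
  by split; rewrite /= expr0n /= add0r ?sqrrN sqrtr_sqr ger0_norm //; lra.
have b2 : normc basepoint = 1 / 2 by rewrite normc_real ger0_norm //; lra.
apply: joined_trans wz.
have [wi|wi] := leP 0 (complex.Im w).
  apply: (@joined_trans _ _ (0 +i* (1 / 2))); apply: chord_in_skeleton => //=.
  by rewrite /=; lra.
apply: (@joined_trans _ _ (0 +i* (- (1 / 2)))); apply: chord_in_skeleton => //=.
by rewrite /=; lra.
Qed.

Lemma real_segment_in_skeleton x z (d : R) :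
  complex.Im x = 0 -> complex.Im z = 0 -> skeleton x -> skeleton z ->
  normc (z - x) < d -> d <= normc x ->
  joined (skeleton `&` cball x d) x z.
Proof.
move=> xi zi xs zs xd dx; rewrite (realE xi) (realE zi) in xs zs xd dx *.
set a := complex.Re x in xs zs xd dx *; set c := complex.Re z in xs zs xd dx *.
have m0 : 0 < 1 / (M + 1) by apply: divr_gt0; have := M1; lra.
have in_skel s : `|s| < 1 -> 1 / (M + 1) <= `|s| -> skeleton s%:C.
  by move=> h1 h2; split; rewrite ?normc_real //; right.
have skel_ge s : skeleton s%:C -> `|s| < 1 /\ 1 / (M + 1) <= `|s|.
  move=> h; have := Sigma_real_ge (skeleton_sub h); case: h => [+ _].
  by rewrite normc_real.
have [a1 am] := skel_ge _ xs; have [c1 cm] := skel_ge _ zs.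
move: xd dx; rewrite -rmorphB !normc_real => ca da.
apply: joined_segment => t t0 t1.
have -> : a%:C + t%:C * (c%:C - a%:C) = (a + t * (c - a))%:C.
  by rewrite rmorphD rmorphM rmorphB.
split; last first.
  suff : normc ((a + t * (c - a))%:C - a%:C) < d by [].
  rewrite -rmorphB normc_real addrAC subrr add0r normrM ger0_norm //.
  by apply: le_lt_trans ca; rewrite ler_piMl.
move: a1 am c1 cm ca da; rewrite ltr_norml => /andP[h1 h2] am.
rewrite ltr_norml => /andP[h3 h4] cm; rewrite ltr_norml => /andP[h5 h6] da.
apply: in_skel.
  by rewrite ltr_norml; have [th|th] := leP t (1 / 2); apply/andP; split; nra.
move: am cm da; rewrite !ler_normr.
have [ha|ha] := leP 0 a.
  move=> am cm da; apply/orP; left.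
  have am' : 1 / (M + 1) <= a by case/orP: am; lra.
  have da' : d <= a by case/orP: da; lra.
  have cm' : 1 / (M + 1) <= c by case/orP: cm; lra.
  nra.
move=> am cm da; apply/orP; right.
have am' : 1 / (M + 1) <= - a by case/orP: am; lra.
have da' : d <= - a by case/orP: da; lra.
have cm' : 1 / (M + 1) <= - c by case/orP: cm; lra.
nra.
Qed.

(** Away from the real segments, go from [x] to [(1 + i y) x] and then to [z],
where [z / x] has imaginary part [y]: the modulus never drops below the
smaller of those of [x] and [z]. *)
Lemma annulus_joined x z (d : R) :
  r <= normc x -> r <= normc z -> normc (z - x) < d -> d <= normc x ->
  d <= 1 - normc x -> joined (skeleton `&` cball x d) x z.
Proof.
move=> xr zr zx dx dx1.
have nx : 0 < normc x := lt_le_trans r_gt0 xr.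
have x0 : x != 0 by rewrite -normc_gt0.
pose u := z / x; pose p := complex.Re u; pose q := complex.Im u.
have uE : p +i* q = u by rewrite /p /q; case: (u).
have zE : z = (p +i* q) * x by rewrite uE divfK.
have dist a b : normc ((a +i* b) * x - x) = normc ((a - 1) +i* b) * normc x.
  have -> : (a - 1) +i* b = (a +i* b) - 1.
    by apply/eqP; rewrite eq_complex /= subr0 !eqxx.
  by rewrite -normcM mulrBl mul1r.
have near a b : (a - 1) ^+ 2 <= (p - 1) ^+ 2 -> b ^+ 2 <= q ^+ 2 ->
    normc ((a +i* b) * x - x) < d.
  move=> ha hb; apply: le_lt_trans zx; rewrite zE !dist ler_wpM2r ?normc_ge0 //.
  rewrite -(@ler_pXn2r _ 2) ?nnegrE ?normc_ge0 // !sqr_normcE /=; lra.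
(* [z] lies on the same side of 0 as [x] because [d <= |x|] *)
have p0 : 0 < p.
  have : normc (z - x) < normc x by apply: lt_le_trans dx.
  rewrite zE dist gtr_pMl // => h.
  have := le_lt_trans (normc_Re_le _) h; rewrite /= ltr_norml => /andP[]; lra.
have skel a b : normc ((a +i* b) * x - x) < d -> r <= normc ((a +i* b) * x) ->
    (skeleton `&` cball x d) ((a +i* b) * x).
  move=> h1 h2; split=> //; split; last by left.
  have := normcB_triangle x ((a +i* b) * x) 0; rewrite !subr0; lra.
have ge1 a b : 1 <= a ^+ 2 + b ^+ 2 -> r <= normc ((a +i* b) * x).
  move=> h; apply: le_trans xr _; rewrite normcM ler_peMl ?normc_ge0 //.
  by rewrite -(@ler_pXn2r _ 2) ?nnegrE ?normc_ge0 // sqr_normcE expr1n.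
have geu a b : p ^+ 2 + q ^+ 2 <= a ^+ 2 + b ^+ 2 -> r <= normc ((a +i* b) * x).
  move=> h; apply: le_trans zr _; rewrite zE !normcM ler_wpM2r ?normc_ge0 //.
  by rewrite -(@ler_pXn2r _ 2) ?nnegrE ?normc_ge0 // !sqr_normcE.
apply: (@joined_trans _ _ ((1 +i* q) * x)); apply: joined_segment => t t0 t1.
  have -> : x + t%:C * ((1 +i* q) * x - x) = (1 +i* (t * q)) * x.
    have -> : 1 +i* (t * q) = 1 + t%:C * ((1 +i* q) - 1).
      by apply/eqP; rewrite eq_complex /=; apply/andP; split; apply/eqP; ring.
    by ring.
  have tq : (t * q) ^+ 2 <= q ^+ 2 by rewrite exprMn ler_piMl ?sqr_ge0 // exprn_ile1.
  apply: skel; first by apply: near tq; rewrite subrr expr0n sqr_ge0.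
  by apply: ge1; rewrite expr1n lerDl sqr_ge0.
have -> : (1 +i* q) * x + t%:C * (z - (1 +i* q) * x) = ((1 + t * (p - 1)) +i* q) * x.
  rewrite zE -mulrBl mulrA -mulrDl; congr (_ * x).
  by apply/eqP; rewrite eq_complex /=; apply/andP; split; apply/eqP; ring.
apply: skel.
  apply: near => //; rewrite addrAC subrr add0r exprMn ler_piMl ?sqr_ge0 //.
  exact: exprn_ile1.
have q0 := sqr_ge0 q.
have [p1|p1] := leP 1 p.
  have h : 1 <= 1 + t * (p - 1) by rewrite lerDl mulr_ge0 ?subr_ge0.
  by apply: ge1; rewrite !expr2 in q0 *; nra.
have h : p <= 1 + t * (p - 1) by nra.
by apply: geu; rewrite lerD2r lerXn2r ?nnegrE //; lra.
Qed.

Lemma skeleton_locally_joined x (e : R) : SigmaS x -> 0 < e ->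
  exists2 d : R, 0 < d & d <= e /\ forall z, skeleton z -> normc (z - x) < d ->
    joined (SigmaS `&` cball x e) x z.
Proof.
move=> Sx e0; have [x1 [_ [_ _ [x0 _]]]] := (SigmaP SM x).1 Sx.
have nx : 0 < normc x by rewrite normc_gt0.
have nx1 : 0 < 1 - normc x by lra.
have [d0 d00 [d0x d0x1]] := pos_lower_bound nx nx1.
have [d1 d10 [d1d d1e]] := pos_lower_bound d00 e0.
have wid (d : R) z : d <= e -> joined (skeleton `&` cball x d) x z ->
    joined (SigmaS `&` cball x e) x z.
  move=> de; apply: joined_sub => w [/skeleton_sub ws wd]; split=> //.
  exact: lt_le_trans de.
(* keep away from the real line unless [x] is on it, and from the annulus
   unless [x] is in it *)
have [d2 d20 [d21 [d2i d2r]]] : exists2 d2 : R, 0 < d2 & d2 <= d1 /\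
    (complex.Im x = 0 \/ d2 <= `|complex.Im x|) /\ (r <= normc x \/ d2 <= r - normc x).
  have [i0|i0] := eqVneq (complex.Im x) 0; have [rx|rx] := leP r (normc x).
  - by exists d1 => //; split=> //; split; left.
  - have rx0 : 0 < r - normc x by lra.
    have [s s0 [s1 s2]] := pos_lower_bound d10 rx0.
    exists s => //; split; first exact: ltW.
    by split; [left | right; exact: ltW].
  - have ni : 0 < `|complex.Im x| by rewrite normr_gt0.
    have [s s0 [s1 s2]] := pos_lower_bound d10 ni.
    exists s => //; split; first exact: ltW.
    by split; [right; exact: ltW | left].
  - have rx0 : 0 < r - normc x by lra.
    have ni : 0 < `|complex.Im x| by rewrite normr_gt0.
    have [s' s'0 [s'1 s'2]] := pos_lower_bound d10 ni.
    have [s s0 [s1 s2]] := pos_lower_bound s'0 rx0.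
    exists s => //; split; first by apply/ltW/(lt_trans s1).
    by split; right; apply/ltW => //; apply: lt_trans s'2.
exists d2 => //; split=> [|z zs zx]; first by lra.
have real_case : complex.Im z = 0 -> joined (SigmaS `&` cball x e) x z.
  move=> zi; have xi : complex.Im x = 0.
    case: d2i => // d2i; have := normc_Im_le (z - x); rewrite raddfB /= zi sub0r normrN.
    lra.
  apply: (wid d2); first lra.
  apply: real_segment_in_skeleton => //; last lra.
  by case: (Sigma_cases Sx) => [//|[/eqP]].
have [z1 [zr|[zi _]]] := zs; last exact: real_case.
apply: (wid d2); first lra.
apply: annulus_joined => //; try lra.
case: d2r => // d2r; have := normcB_triangle x z 0; rewrite !subr0; lra.
Qed.

End Skeleton.

(** * Connectedness and local connectedness of Sigma *)

Section SigmaConnected.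
Local Open Scope complex_scope.
Variables (R : realType) (S : {fset R}) (M r : R).
Hypothesis SMr : dense_digits S M r.
Let SM := digit_le SMr.
Let r_gt0 := radius_gt0 SMr.
Let r_le := radius_le SMr.
Let r_lt1 : r < 1. Proof. by have := r_le; lra. Qed.
Let M1 : 1 <= M. Proof. by have := SM (digit1 SMr); rewrite normr1. Qed.
Implicit Types (x z w : R[i]) (f g : nat -> R) (n : nat).

Notation SigmaS := (Sigma (set_of_reals S)).
Notation skel := (skeleton M r).

Lemma cyl_root_limit n f0 z : (0 < n)%N -> f0 0%N = 1 ->
  (forall d : R, 0 < d -> exists2 x, cyl_root S r n f0 x & normc (x - z) < d) ->
  [/\ 0 <= complex.Im z, normc z <= r &
    exists f, [/\ coefs S f, agree n f f0 & root_of f z]].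
Proof.
move=> n0 f00 h.
have zi : 0 <= complex.Im z.
  rewrite leNgt; apply/negP => zi; have ni : 0 < - complex.Im z by lra.
  have [x [[xi _] _] xz] := h _ ni.
  by have := le_lt_trans (normc_Im_le _) xz; rewrite raddfB /= ltr_norml => /andP[]; lra.
have zr : normc z <= r.
  apply/ler_addgt0Pr => e e0; have [x [[_ xr] _] xz] := h _ e0.
  by have := normcB_ge z x; rewrite normcBC; lra.
split=> //.
have [|f [fS ff0 hf]] := @root_accumulation R S (fun x => normc x <= r) z n f0.
  move=> d d0; have [x [[_ xr] [g [gS gf gx]]] xz] := h d d0.
  by exists x, g; split=> //; exact: ltW.
exists f; split=> //.
apply: (root_limit (coefs_le SMr fS) _ (ltW r_gt0) r_lt1 (le_lt_trans zr r_lt1)).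
  by rewrite ff0 // f00 normr1.
move=> m d d0; have [x [g [xr xz gS gf gx]]] := hf m d d0.
by exists x, g; split=> //; exact: (coefs_le SMr gS).
Qed.

Lemma cyl_root_Sigma n f0 z : (0 < n)%N -> f0 0%N = 1 -> normc z <= r ->
  (exists f, [/\ coefs S f, agree n f f0 & root_of f z]) -> SigmaS z.
Proof.
move=> n0 f00 zr [f [fS ff0 fz]]; apply/(SigmaP SM); split.
  exact: (le_lt_trans zr r_lt1).
by exists f; split=> //; rewrite ff0 // f00 oner_eq0.
Qed.

Lemma no_root_one z : normc z < 1 -> ~ root_of (fun i => if i is 0 then 1 else 0 : R) z.
Proof.
move=> z1 hz; set f := (fun i => _) in hz.
have fM i : normc (cseq f i) <= 1.
  by rewrite normc_real; case: i => [|i] /=; rewrite ?normr1 ?normr0 ?ler01.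
have psum1 n : psum (cseq f) n.+1 z = 1.
  rewrite /psum big_ord_recl big1 ?addr0 ?expr0 ?mulr1 // => i _.
  by rewrite /cseq /= mul0r.
suff : (1 : R) <= 0 by rewrite ler10.
apply: (@le0_of_geometric R (normc z) (1 - normc z)^-1 _ 1) => //; first exact: normc_ge0.
case=> // n _; have := series_root_psum fM z1 hz n.
by rewrite psum1 normc1 mul1r mulrC.
Qed.

(** Such a part would contain a root of every series with leading coefficient 1,
in particular of the constant series 1. *)
Lemma clopen_nonupper K O F : clopen_in SigmaS K O F ->
  ~ K (basepoint R) -> forall z, K z -> ~ upper r z.
Proof.
move=> cK nKb z Kz uz; have [oO cF KO KF] := cK.
have KS x : K x -> SigmaS x by rewrite KO => -[].
have nskel x : K x -> ~ skel x.
  move=> Kx xs; apply: nKb; apply: (joined_clopen cK _ Kx); apply: joined_sym.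
  apply: (joined_sub (skeleton_sub SMr)); exact: (skeleton_joined SMr).
pose one i : R := if i is 0 then 1 else 0.
have one_coefs : coefs S one by case=> [|i]; [exact: (digit1 SMr) | exact: (digit0 SMr)].
pose K' x := K x /\ upper r x.
have K'cyl x : K' x -> cyl_root S r 1 one x.
  move=> [Kx ux]; split=> //.
  have [xs|[_ _ [f [fS f0 fx]]]] := Sigma_cases SMr (KS _ Kx); first by case: (nskel _ Kx).
  by exists f; split=> // -[].
have K'cl w : (forall d : R, 0 < d -> exists2 x, K' x & normc (x - w) < d) -> K' w.
  move=> hw.
  have [wi wr wf] := cyl_root_limit (ltn0Sn 0) (erefl : one 0%N = 1)
    (fun d d0 => let: ex_intro2 x h1 h2 := hw d d0 in ex_intro2 _ _ x (K'cyl x h1) h2).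
  have Sw := cyl_root_Sigma (ltn0Sn 0) (erefl : one 0%N = 1) wr wf.
  have Kw : K w.
    rewrite KF; split=> //; apply: ((closed_normcP F).1 cF) => d d0.
    by have [x [Kx _] xw] := hw d d0; exists x => //; move: Kx; rewrite KF => -[].
  split=> //; have [ws|[wi' wr' _]] := Sigma_cases SMr Sw; first by case: (nskel _ Kw).
  by split=> //; rewrite lt_def wi'.
have K'op w : K' w -> exists2 d : R, 0 < d &
    forall x, cyl_root S r 1 one x -> normc (x - w) < d -> K' x.
  move=> [Kw uw]; have Ow : O w by move: Kw; rewrite KO => -[].
  have [d d0 hd] := (open_normcP O).1 oO w Ow; exists d => // x [ux hx] xw.
  split=> //; rewrite KO; split; last exact: hd.
  exact: (cyl_root_Sigma (ltn0Sn 0) (erefl : one 0%N = 1) (ltW ux.2) hx).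
have K'ne : exists w, K' w by exists z.
have [w [Kw uw] rw] := clopen_roots_all SMr (ltn0Sn 0) (erefl : one 0%N = 1)
  K'cyl K'cl K'op K'ne one_coefs (fun i _ => erefl).
by apply: no_root_one rw; apply: lt_trans uw.2 r_lt1.
Qed.

Lemma conj_continuous_open (O : set R[i]) : open O -> open [set z | O z^*].
Proof.
move=> oO; apply/open_normcP => z Oz; have [d d0 hd] := (open_normcP O).1 oO _ Oz.
by exists d => // x xz; apply: hd; rewrite -rmorphB normc_conj.
Qed.

Lemma clopen_conj K O F : clopen_in SigmaS K O F ->
  clopen_in SigmaS [set z | K z^*] [set z | O z^*] [set z | F z^*].
Proof.
move=> [oO cF KO KF].
have Sc z : SigmaS z^* <-> SigmaS z.
  by split=> [/(Sigma_conj SMr)|/(Sigma_conj SMr)//]; rewrite conjcK.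
split; first exact: conj_continuous_open.
- rewrite -openC; apply: (@conj_continuous_open (~` F)); exact: closed_openC.
- by apply/seteqP; split=> z /=; rewrite KO => -[/Sc ? ?].
- by apply/seteqP; split=> z /=; rewrite KF => -[/Sc ? ?].
Qed.

Lemma Sigma_connected : connected SigmaS.
Proof.
apply: (@connected_from_point _ _ (basepoint R)); last first.
  exact: (skeleton_sub SMr (skeleton_basepoint SMr)).
move=> K O F cK nKb z Kz; have [oO cF KO KF] := cK.
have Sz : SigmaS z by move: Kz; rewrite KO => -[].
have [zs|[zi zr _]] := Sigma_cases SMr Sz.
  apply: nKb; apply: (joined_clopen cK _ Kz); apply: joined_sym.
  apply: (joined_sub (skeleton_sub SMr)); exact: (skeleton_joined SMr).
have [zi'|zi'] := ltP 0 (complex.Im z).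
  by apply: (clopen_nonupper cK nKb Kz).
apply: (clopen_nonupper (clopen_conj cK) _ (z := z^*)).
- have e : (basepoint R)^* = basepoint R := conjc_real _.
  by change (~ K (basepoint R)^*); rewrite e.
- by rewrite /= conjcK.
- split; last by rewrite normc_conj.
  by case: (z) zi zi' => a b /= b0 b1; rewrite oppr_gt0 lt_def eq_sym b0.
Qed.

(** If nonreal points that cannot be joined to [x] accumulated at [x], then
[root_accumulation] would give a series [f] with root [x] that shares arbitrarily
long prefixes with series having such roots. The roots [Z] of the series with a
long common prefix lie near [x]; a clopen part of them away from [x] would
contain a second root of [f], by [clopen_roots_all]. *)
Lemma upper_locally_joined x (e : R) : SigmaS x -> 0 < e ->
  exists2 d : R, 0 < d & forall z, SigmaS z -> upper r z -> normc (z - x) < d ->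
    joined (SigmaS `&` cball x e) x z.
Proof.
move=> Sx e0; have [x1 _] := (SigmaP SM x).1 Sx.
have [rx|xr] := ltP r (normc x).
  exists (normc x - r); first by rewrite subr_gt0.
  by move=> z _ [_ zr]; have := normcB_ge x z; rewrite normcBC; lra.
apply: contrapT => hno; set A := SigmaS `&` cball x e in hno.
pose one i : R := if i is 0 then 1 else 0.
pose T z := [/\ SigmaS z, upper r z & ~ joined A x z].
have accum (d : R) : 0 < d -> exists z, exists g,
    [/\ T z, normc (z - x) < d, coefs S g, agree 1 g one & root_of g z].
  move=> d0; apply: contrapT => hd; apply: hno; exists d => // z Sz uz zx.
  apply: contrapT => nj; apply: hd.
  have [zs|[_ _ [g [gS g0 gz]]]] := Sigma_cases SMr Sz.
    by case: (upper_nonskeleton _ uz.2 zs); rewrite gt_eqF ?uz.1.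
  by exists z, g; split=> // -[].
have [f [fS f1 hf]] := root_accumulation accum.
have f0 : f 0%N = 1 by rewrite f1.
have xi : 0 <= complex.Im x.
  rewrite leNgt; apply/negP => xi; have ni : 0 < - complex.Im x by lra.
  have [z [_ [[_ [zi _] _] xz _ _ _]]] := accum _ ni.
  by have := le_lt_trans (normc_Im_le _) xz; rewrite raddfB /= ltr_norml => /andP[]; lra.
have fx : root_of f x.
  apply: (root_limit (coefs_le SMr fS) _ (ltW r_gt0) r_lt1 x1); first by rewrite f0 normr1.
  move=> m d d0; have [z [g [[_ [_ zr] _] zx gS gf gz]]] := hf m d d0.
  by exists z, g; split=> //; [exact: ltW | exact: (coefs_le SMr gS)].
have [d d0 [de hd]] := skeleton_locally_joined SMr Sx e0.
have [n hn] := radius_small SMr d0; have {}hn := hn n.+1 (leqnSn _).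
pose Z := cyl_root S r n.+1 f.
have near z : Z z -> normc (z - x) <= radius M r n.+1.
  move=> [[zi zr] [g [gS gf gz]]]; rewrite normcBC.
  exact: (upper_roots_close SMr fS gS f0 (agree_sym gf) xr xi fx (ltW zr) zi gz).
have ZS z : Z z -> SigmaS z.
  by move=> [[_ zr] hz]; apply: (cyl_root_Sigma (ltn0Sn n) f0 (ltW zr)).
have ZA z : Z z -> A z.
  move=> Zz; split; first exact: ZS.
  by apply: le_lt_trans (near z Zz) _; apply: lt_le_trans de.
pose Y := [set z | joined A x z].
have Ax : A x by split=> //; rewrite /cball /= subrr normc0.
have Yx : Y x by exists [set x]; split=> //; [exact: connected1 | move=> _ ->].
have YA : Y `<=` A by move=> z /joined_in.
have Yj z : Y z -> joined Y x z.
  by move=> [W [cW WA Wx Wz]]; exists W; split=> // t Wt; exists W.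
pose W := Y `|` Z.
have WA : W `<=` A by move=> z [/YA|/ZA].
have [z [g [[Sz uz nj] _ gS gf gz]]] := hf n.+1 1 ltr01.
suff cW : connected W.
  apply: nj; exists W; split=> //; first by left.
  by right; split=> //; exists g.
apply: (@connected_from_point _ _ x); last by left.
move=> K O F cK nKx w Kw; have [oO cF KO KF] := cK.
have KZ t : K t -> Z t.
  move=> Kt; have : W t by move: Kt; rewrite KO => -[].
  case=> // Yt; case: nKx; apply: (joined_clopen cK _ Kt); apply: joined_sym.
  by apply: joined_sub (Yj t Yt) => ?; left.
have nKY t : K t -> ~ Y t.
  move=> Kt Yt; apply: nKx; apply: (joined_clopen cK _ Kt); apply: joined_sym.
  by apply: joined_sub (Yj t Yt) => ?; left.
have Kcl t : (forall s : R, 0 < s -> exists2 y, K y & normc (y - t) < s) -> K t.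
  move=> ht.
  have [ti tr tf] := cyl_root_limit (ltn0Sn n) f0
    (fun d d0 => let: ex_intro2 y h1 h2 := ht d d0 in ex_intro2 _ _ y (KZ y h1) h2).
  have St := cyl_root_Sigma (ltn0Sn n) f0 tr tf.
  have Ft : F t.
    apply: ((closed_normcP F).1 cF) => s s0.
    by have [y Ky yt] := ht s s0; exists y => //; move: Ky; rewrite KF => -[].
  have tx : normc (t - x) < d.
    apply: le_lt_trans hn; apply/ler_addgt0Pr => s s0.
    have [y Ky yt] := ht s s0; have := near y (KZ y Ky).
    by have := normcB_triangle y t x; rewrite (normcBC t y); lra.
  rewrite KF; split=> //.
  have [ts|[ti' tr' _]] := Sigma_cases SMr St; first by left; apply: hd.
  by right; split=> //; split=> //; rewrite lt_def ti'.
have Kop t : K t -> exists2 s : R, 0 < s &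
    forall y, Z y -> normc (y - t) < s -> K y.
  move=> Kt; have Ot : O t by move: Kt; rewrite KO => -[].
  have [s s0 hs] := (open_normcP O).1 oO t Ot; exists s => // y Zy yt.
  by rewrite KO; split; [right | exact: hs].
have Kne : exists t, K t by exists w.
have [t Kt ft] := clopen_roots_all SMr (ltn0Sn n) f0 KZ Kcl Kop Kne fS (fun i _ => erefl).
have [[ti tr] _] := KZ t Kt.
have xt := upper_root_unique SMr fS f0 xr xi fx (ltW tr) ti ft.
by apply: nKx; rewrite xt.
Qed.

Lemma joined_conj x z (e : R) :
  joined (SigmaS `&` cball x^* e) x^* z^* -> joined (SigmaS `&` cball x e) x z.
Proof.
move=> [W [cW WA Wx Wz]]; exists [set t^* | t in W]; split.
- apply: connected_continuous_connected => //; apply: continuous_subspaceT => t.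
  apply: continuous_to_complex => d d0.
  by apply/nbhs_normcP; exists d => // s; rewrite -rmorphB normc_conj.
- move=> _ [t /WA [St tx] <-]; split; first exact: (Sigma_conj SMr).
  by move: tx; rewrite /cball /= -[t in normc (t - _)]conjcK -rmorphB normc_conj.
- by exists x^* => //; rewrite conjcK.
- by exists z^* => //; rewrite conjcK.
Qed.

Lemma Sigma_locally_connected : locally_connected SigmaS.
Proof.
apply: locally_connected_of_joined => x e Sx e0.
have [d1 d10 [_ h1]] := skeleton_locally_joined SMr Sx e0.
have [d2 d20 h2] := upper_locally_joined Sx e0.
have [d3 d30 h3] := upper_locally_joined (Sigma_conj SMr Sx) e0.
have [d4 d40 [d41 d42]] := pos_lower_bound d10 d20.
have [d d0 [dd4 dd3]] := pos_lower_bound d40 d30.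
exists d => // z Sz zx.
have [zs|[zi zr _]] := Sigma_cases SMr Sz; first by apply: h1 => //; lra.
have [zi'|zi'] := ltP 0 (complex.Im z); first by apply: h2 => //; lra.
apply: joined_conj; apply: h3; first exact: (Sigma_conj SMr).
- split; last by rewrite normc_conj.
  by case: (z) zi zi' => a b /= b0 b1; rewrite oppr_gt0 lt_def eq_sym b0.
- by rewrite -rmorphB normc_conj; lra.
Qed.

End SigmaConnected.

(** * Gaps of a finite set of reals *)

Section Gaps.
Local Open Scope complex_scope.
Variables (R : realType) (S : {fset R}).
Let s := sort <=%O (enum_fset S).

Let mem_s a : (a \in s) = (a \in S).
Proof. by rewrite mem_sort. Qed.

Let s_lt i j : (i < j)%N -> (j < size s)%N -> s`_i < s`_j.
Proof.
move=> ij js; have so : sorted <%O s.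
  by rewrite lt_sorted_uniq_le sort_uniq fset_uniq sort_le_sorted.
by apply: (sorted_ltn_nth lt_trans) => //; rewrite inE // (ltn_trans ij).
Qed.

Lemma fset_max : S != fset0 -> exists2 M, M \in S & forall a, a \in S -> a <= M.
Proof.
move=> S0; have s0 : (0 < size s)%N.
  rewrite size_sort; case/fset0Pn: S0 => x.
  by rewrite -[x \in S]/(x \in enum_fset S); case: (enum_fset S).
exists s`_(size s).-1; first by rewrite -mem_s mem_nth // prednK.
move=> a; rewrite -mem_s => /(nthP 0) [i hi <-].
have [->|ne] := eqVneq i (size s).-1; first exact: lexx.
by apply/ltW/s_lt; rewrite ?prednK // ltn_neqAle ne -ltnS prednK.
Qed.

Lemma chain_of_total_gap (g : R) (Q : R -> Prop) : total_gap S <= g ->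
  (forall a b, a \in S -> b \in S -> a < b -> b <= a + g -> (Q a <-> Q b)) ->
  forall a b, a \in S -> b \in S -> Q a -> Q b.
Proof.
move=> tg h.
have step j : (j.+1 < size s)%N -> (Q s`_j <-> Q s`_j.+1).
  move=> js; have lt := s_lt (ltnSn j) js.
  apply: h => //; rewrite -?mem_s ?mem_nth // ?(ltn_trans _ js) //.
  have js' : (j < (size s).-1)%N by rewrite ltn_predRL.
  have := le_bigmax 0 (fun j : 'I_(size s).-1 => `|s`_j.+1 - s`_j|) (Ordinal js').
  by move=> /le_trans /(_ tg); rewrite /= ger0_norm; lra.
have all0 j : (j < size s)%N -> (Q s`_0 <-> Q s`_j).
  elim: j => [//|j IH] js.
  exact: iff_trans (IH (ltn_trans (ltnSn j) js)) (step j js).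
move=> a b; rewrite -!mem_s => /(nthP 0) [i hi <-] /(nthP 0) [j hj <-].
by move=> /(all0 i hi).2 /(all0 j hj).1.
Qed.

Lemma gap_of_total_gap (g : R) : 0 < g -> g <= total_gap S ->
  exists a b, [/\ a \in S, b \in S, a + g <= b & forall c, c \in S -> c <= a \/ b <= c].
Proof.
move=> g0 tg.
have [j hj] : exists j : 'I_(size s).-1, g <= `|s`_j.+1 - s`_j|.
  apply: contrapT => hno; move: tg; apply/negP; rewrite -ltNge.
  apply: bigmax_lt => // j _; rewrite ltNge; apply/negP => hj; apply: hno; by exists j.
have js : (j.+1 < size s)%N by rewrite -ltn_predRL.
have lt := s_lt (ltnSn j) js.
exists s`_j, s`_j.+1; split.
- by rewrite -mem_s mem_nth // (ltn_trans _ js).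
- by rewrite -mem_s mem_nth.
- by move: hj; rewrite ger0_norm; lra.
- move=> c; rewrite -mem_s => /(nthP 0) [i hi <-].
  have [ij|ji|->] := ltngtP i j; last by left.
    by left; apply/ltW/s_lt => //; apply: ltn_trans js.
  right; move: ji; rewrite leq_eqVlt => /orP[/eqP <- //|ji].
  by apply/ltW/s_lt.
Qed.

End Gaps.

(** * Integer digits *)

Section Integers.
Local Open Scope complex_scope.
Variable R : realType.
Implicit Types a b : R.

Lemma int_lt_le a b : a \is a Num.int -> b \is a Num.int -> a < b -> a + 1 <= b.
Proof.
by move=> /intrP [m ->] /intrP [n ->]; rewrite ltr_int -[1]/(1%:~R) -rmorphD /= ler_int lezD1.
Qed.

Lemma int_step a b : a \is a Num.int -> b \is a Num.int -> a < b -> b <= a + 2 ->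
  b = a + 1 \/ b = a + 2.
Proof.
move=> ai bi ab b2; have h := int_lt_le ai bi ab.
have [e|ne] := eqVneq b (a + 1); first by left.
right; have a1 : a + 1 \is a Num.int by rewrite rpredD ?rpred1.
have := int_lt_le a1 bi; rewrite lt_def ne h => /(_ isT).
lra.
Qed.

Lemma int_small a : a \is a Num.int -> a != 0 -> `|a| < 2 -> a = 1 \/ a = -1.
Proof.
move=> ai a0; rewrite ltr_norml => /andP[h1 h2].
have [ap|an] := ltP 0 a.
  have := int_lt_le (rpred0 _) ai ap => h3.
  have [e|ne] := eqVneq a 1; first by left.
  by have := int_lt_le (rpred1 _) ai; rewrite lt_def ne; lra.
have an' : a < 0 by rewrite lt_neqAle a0.
have h3 := int_lt_le ai (rpred0 _) an'.
have [e|ne] := eqVneq a (-1); first by right.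
have m1 : -1 \is a @Num.int R by rewrite rpredN rpred1.
have := int_lt_le ai m1; rewrite lt_neqAle ne; lra.
Qed.

End Integers.

(** * Digits with gaps at most two *)

Section DenseDigits.
Local Open Scope complex_scope.
Variables (R : realType) (S : {fset R}) (M : R).
Hypothesis S_int : forall s, s \in S -> s \is a Num.int.
Hypothesis SN : forall s, s \in S -> - s \in S.
Hypothesis S_0 : 0 \in S.
Hypothesis S_1 : 1 \in S.
Hypothesis MS : M \in S.
Hypothesis M_max : forall s, s \in S -> s <= M.

Lemma digit_abs_le s : s \in S -> `|s| <= M.
Proof. by move=> sS; rewrite ler_norml lerNl !M_max ?SN. Qed.

Lemma gap_two_dense_digits : total_gap S <= 2 -> 40 <= M ->
  dense_digits S M (Num.sqrt (M + 2) - 1)^-1.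
Proof.
move=> tg M40; set b := Num.sqrt (M + 2) - 1.
have b1 : (b + 1) ^+ 2 = M + 2 by rewrite subrK sqr_sqrtr //; lra.
have bn1 : 0 <= b + 1 by rewrite subrK sqrtr_ge0.
have b5 : 5 <= b by rewrite !expr2 in b1; nra.
(* [M ^ 2 - 40 M + 16 > 0]; this is where [M >= 40] is needed *)
have b8 : 8 * b < M + 4 by rewrite !expr2 in b1; nra.
have b0 : 0 < b by lra.
have rb : b^-1 * b = 1 by rewrite mulVf // lt0r_neq0.
have r0 : 0 < b^-1 by rewrite invr_gt0.
split=> //.
- exact: digit_abs_le.
- by move=> x y xS yS; apply: int_step; apply: S_int.
- by move=> Q; apply: chain_of_total_gap.
- move=> t; rewrite ler_norml => /andP[t1 t2].
  apply: contrapT => hno.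
  have far s : s \in S -> s < t - 1 \/ t + 1 < s.
    move=> sS; apply: contrapT => h; apply: hno; exists s => //.
    rewrite ler_norml; apply/andP; split; rewrite leNgt; apply/negP => h'; apply: h;
      [right|left]; lra.
  have low_step x y : x \in S -> y \in S -> x < y -> y <= x + 2 ->
      (x < t - 1 <-> y < t - 1).
    move=> xS yS xy y2; split=> h; last by apply: lt_trans h.
    by have [//|] := far y yS; lra.
  have lowN : - M < t - 1 by have [//|] := far (- M) (SN MS); lra.
  by have := chain_of_total_gap (Q := fun s => s < t - 1) tg low_step (SN MS) MS lowN; lra.
- by move=> s sS s0; apply: int_small => //; apply: S_int.
- by rewrite -[leRHS]invrK lef_pV2 ?posrE; lra.
- have e : M < 2 * (b - 1) ^+ 2 by rewrite !expr2 in b1 *; lra.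
  have p : 0 < b^-1 ^+ 2 by rewrite exprn_gt0.
  have -> : 2 * (1 - b^-1) ^+ 2 = 2 * (b - 1) ^+ 2 * b^-1 ^+ 2.
    by field; rewrite lt0r_neq0.
  by rewrite ltr_pM2r.
- have -> : M + 1 = b ^+ 2 + 2 * b by rewrite !expr2 in b1 *; lra.
  by field; rewrite lt0r_neq0.
Qed.

End DenseDigits.

(** * A circle that avoids Sigma *)

Section LargeGap.
Local Open Scope complex_scope.
Variables (R : realType) (S : {fset R}) (M a c : R).
Hypothesis S_int : forall s, s \in S -> s \is a Num.int.
Hypothesis SN : forall s, s \in S -> - s \in S.
Hypothesis S_1 : 1 \in S.
Hypothesis MS : M \in S.
Hypothesis M_max : forall s, s \in S -> s <= M.
Hypothesis a_ge1 : 1 <= a.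
Hypothesis ac : a + 3 <= c.
Hypothesis cS : c \in S.
Hypothesis gap : forall s, s \in S -> s <= a \/ c <= s.
Implicit Types (z : R[i]) (f : nat -> R).

Notation SigmaS := (Sigma (set_of_reals S)).

Let SM := digit_abs_le SN M_max.
Let M4 : 4 <= M. Proof. have := M_max cS; have := a_ge1; have := ac; lra. Qed.
Let h := (a + c) / 2.
Let h_ge : 5 / 2 <= h. Proof. rewrite /h; have := a_ge1; have := ac; lra. Qed.
Let h_lt : h < M. Proof. rewrite /h; have := M_max cS; have := ac; lra. Qed.
Let h_far s : s \in S -> 3 / 2 <= `|h - s|.
Proof.
move=> sS; rewrite ler_normr /h; have := ac.
by case: (gap sS) => h1 h2; apply/orP; [left | right]; lra.
Qed.

(* for [b > beta0], the bound [M / (b - 1)] on remainders is below [1 + 2 / (M + 1)] *)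
Let beta0 := 1 + M * (M + 1) / (M + 3).

Let beta0_lt : beta0 < M + 1.
Proof.
rewrite /beta0 addrC ltrD2r ltr_pdivrMr; have := M4 => M4'; last lra.
by rewrite ltr_pM2l; lra.
Qed.

(** The orbit of 1 under [t |-> X t - M], as polynomials in the base. *)
Fixpoint orbit_poly n : {poly R} :=
  if n is m.+1 then 'X * orbit_poly m - M%:P else 1.

Lemma orbit_polyS n (b : R) : (orbit_poly n.+1).[b] = b * (orbit_poly n).[b] - M.
Proof. by rewrite /= !hornerE. Qed.

(** In base [M + 1] the orbit of 1 is constant; in a smaller base it tends to
minus infinity, since the fixed point [M / (b - 1)] exceeds 1 and is repelling.
In between, some iterate takes the required value. *)
Lemma orbit_hits_gap : exists b n,
  [/\ beta0 < b, b < M + 1 & b * (orbit_poly n).[b] = h].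
Proof.
have M4' := M4; have lt := beta0_lt.
pose b1 := (beta0 + (M + 1)) / 2.
have [b1l b1u] : beta0 < b1 /\ b1 < M + 1 by rewrite /b1; split; lra.
have b01 : 1 < beta0.
  by rewrite /beta0 ltrDl; apply: divr_gt0; [apply: mulr_gt0|]; lra.
have b11 : 1 < b1 by lra.
pose L := M / (b1 - 1).
have LE : L * (b1 - 1) = M by rewrite /L divfK // lt0r_neq0 // subr_gt0.
have L1 : 1 < L by rewrite /L ltr_pdivlMr; lra.
have orbE n : (orbit_poly n).[b1] = L - (L - 1) * b1 ^+ n.
  elim: n => [|n IH]; first by rewrite /= hornerE expr0; lra.
  by rewrite orbit_polyS IH exprS; move: LE => <-; ring.
have orbM n : (orbit_poly n).[M + 1] = 1.
  by elim: n => [|n IH]; [rewrite /= hornerE | rewrite orbit_polyS IH; lra].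
have [n hn] := exprn_large (L / (L - 1)) b11.
pose q := 'X * orbit_poly n - h%:P.
have qE b : q.[b] = b * (orbit_poly n).[b] - h by rewrite /q !hornerE.
have q1 : q.[b1] <= 0.
  rewrite qE orbE; move: hn; rewrite ltr_pdivrMr; last lra.
  have := h_ge; nra.
have qM : 0 < q.[M + 1] by rewrite qE orbM; have := h_lt; lra.
have [|b /andP[b1b bM] /rootP] := @poly_ivt R q b1 (M + 1) (ltW b1u).
  by rewrite q1 ltW.
rewrite qE => qb; exists b, n; split; [lra | | lra].
rewrite lt_neqAle bM andbT; apply/eqP => e.
by move: qM; rewrite qE -e; lra.
Qed.

Lemma root_alternate f z : root_of f z -> root_of (fun i => (-1) ^+ i * f i) (- z).
Proof.
move=> [z0 [B hB]]; split; first by rewrite oppr_eq0.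
exists B => n.
have -> : divlin (- z)^-1 (cseq (fun i => (-1) ^+ i * f i)) n =
    (-1) ^+ n * divlin z^-1 (cseq f) n.
  elim: n => [|n IH]; first by rewrite /= /cseq /= expr0 !mul1r.
  set u := cseq (fun i => (-1) ^+ i * f i) in IH *.
  have uE : u n.+1 = (-1) ^+ n.+1 * cseq f n.+1.
    by rewrite /u /cseq rmorphM rmorphXn rmorphN1.
  have -> : divlin (- z)^-1 u n.+1 = (- z)^-1 * divlin (- z)^-1 u n + u n.+1 by [].
  have -> : divlin z^-1 (cseq f) n.+1 = z^-1 * divlin z^-1 (cseq f) n + cseq f n.+1 by [].
  by rewrite IH uE invrN exprS; ring.
by rewrite normcM normcX normc_opp normc1 expr1n mul1r.
Qed.

(** In base [b], the remainders [T j] of an expansion with digits in [S] stay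
below [L = M / (b - 1)]; as [L] is hardly more than 1, the first digits are
forced to be [M] until the orbit of 1 is brought into the gap, where no digit
is left. *)
Lemma no_real_root (b : R) n f : beta0 < b -> b < M + 1 ->
  b * (orbit_poly n).[b] = h -> coefs S f -> f 0%N = 1 ->
  ~ root_of f (b^-1)%:C.
Proof.
move=> b0 bM bn fS f0 fr; have M4' := M4; have h_ge' := h_ge.
have b01 : 1 < beta0.
  by rewrite /beta0 ltrDl; apply: divr_gt0; [apply: mulr_gt0|]; lra.
have b1 : 1 < b by lra.
have bp : 0 < b by lra.
pose L := M / (b - 1).
have LE : L * (b - 1) = M by rewrite /L divfK // lt0r_neq0 // subr_gt0.
have L1 : 1 <= L by rewrite /L ler_pdivlMr; lra.
have Lb : L * (M + 1) < M + 3.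
  have : M * (M + 1) / (M + 3) < b - 1 by move: b0; rewrite /beta0; lra.
  rewrite ltr_pdivrMr; last lra.
  move=> hb; have e : L * (M + 1) * (b - 1) = M * (M + 1) by rewrite -LE; ring.
  have b10 : 0 < b - 1 by lra.
  by rewrite -(ltr_pM2r b10) e [ltRHS]mulrC.
have Lh : L < 1 + (orbit_poly n).[b].
  have : 5 / 2 <= (M + 1) * (orbit_poly n).[b].
    have o0 : 0 < (orbit_poly n).[b] by rewrite -(pmulr_rgt0 _ bp) bn; lra.
    apply: (le_trans h_ge'); rewrite -bn ler_pM2r //; lra.
  nra.
have L32 : L < 3 / 2 by nra.
pose T := fix T j : R := if j is k.+1 then b * T k + f k.+1 else 1.
have TE j : divlin ((b^-1)%:C)^-1 (cseq f) j = (T j)%:C.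
  elim: j => [|j IH]; first by rewrite /= /cseq f0.
  have -> : divlin ((b^-1)%:C)^-1 (cseq f) j.+1 =
    ((b^-1)%:C)^-1 * divlin ((b^-1)%:C)^-1 (cseq f) j + (f j.+1)%:C by [].
  by rewrite IH -fmorphV invrK -rmorphM -rmorphD.
have TL j : `|T j| <= L.
  have bi1 : b^-1 < 1 by rewrite invf_lt1.
  have bi0 : 0 < b^-1 by rewrite invr_gt0.
  have nb : normc (b^-1)%:C <= b^-1 by rewrite normc_real ger0_norm // ltW.
  have := root_quotient_le (fun i => SM (fS i)) bi0 bi1 nb fr j.
  rewrite TE normc_real; congr (_ <= _); rewrite /L; field.
  by rewrite !lt0r_neq0 //; lra.
have orbL j : (orbit_poly j).[b] <= L.
  elim: j => [|j IH]; first by rewrite /= hornerE.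
  by rewrite orbit_polyS; nra.
have orb_dec j : (orbit_poly j.+1).[b] <= (orbit_poly j).[b].
  by rewrite orbit_polyS; have := orbL j; nra.
have orb_ge j : (j <= n)%N -> (orbit_poly n).[b] <= (orbit_poly j).[b].
  move=> /subnK <-; elim: (n - j)%N => [|k IH]; first by rewrite add0n.
  by rewrite addSn; apply: le_trans IH.
have forced j : (j <= n)%N -> T j = (orbit_poly j).[b].
  elim: j => [|j IH] jn; first by rewrite /= hornerE.
  rewrite orbit_polyS; have -> : T j.+1 = b * T j + f j.+1 by [].
  rewrite IH; last exact: ltnW.
  have sS := SN (fS j.+1).
  have [e|ne] := eqVneq (- f j.+1) M; first by rewrite -e opprK.
  have lt : - f j.+1 < M by rewrite lt_neqAle ne M_max.
  have := int_lt_le (S_int sS) (S_int MS) lt.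
  have := TL j.+1; have -> : T j.+1 = b * T j + f j.+1 by [].
  rewrite IH; last exact: ltnW.
  rewrite ler_norml => /andP[_]; have := orb_ge j.+1 jn; rewrite orbit_polyS.
  lra.
have := TL n.+1; have -> : T n.+1 = b * T n + f n.+1 by [].
rewrite forced // bn; have := h_far (SN (fS n.+1)); rewrite opprK.
lra.
Qed.

(** Nonreal roots are excluded by [M < (b - 1) ^ 2], and negative roots become
positive when the signs of the coefficients of odd index are changed. *)
Lemma Sigma_misses_circle : exists2 rho : R,
  (M + 1)^-1 < rho < 1 / 2 & forall z, SigmaS z -> normc z != rho.
Proof.
have M4' := M4; have [b [n [b0 bM bn]]] := orbit_hits_gap.
have bl : M + 1 - 2 * M / (M + 3) < b.
  apply: le_lt_trans b0; rewrite /beta0 le_eqVlt; apply/orP; left; apply/eqP.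
  by field; rewrite lt0r_neq0 //; lra.
have M3 : 2 * M / (M + 3) < 2 by rewrite ltr_pdivrMr; lra.
have b2 : 2 < b by lra.
have bM2 : M < (b - 1) ^+ 2.
  have : 2 * M / (M + 3) < M / 3.
    by rewrite ltr_pdivrMr; [nra | lra].
  rewrite expr2; nra.
have bp : 0 < b by lra.
have ML : M / (b - 1) < 2 by rewrite ltr_pdivrMr; lra.
exists b^-1.
  rewrite ltf_pV2 ?posrE //; last lra.
  by rewrite bM div1r ltf_pV2 ?posrE.
move=> z /(SigmaP SM) [z1 [f [fS f0 fz]]]; apply/eqP => zb.
have bi0 : 0 < b^-1 by rewrite invr_gt0.
have bi1 : b^-1 < 1 by rewrite invf_lt1 //; lra.
have fM i : `|f i| <= M by apply: SM.
have f_ge1 : 1 <= `|f 0%N|.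
  rewrite leNgt; apply/negP => lt; have lt2 : `|f 0%N| < 2 by lra.
  by have [e|e] := int_small (S_int (fS 0%N)) f0 lt2; move: lt;
    rewrite e ?normrN normr1 ltxx.
have zr : normc z <= b^-1 by rewrite zb.
have [zi|zi] := eqVneq (complex.Im z) 0; last first.
  have := nonreal_root_lead fM bi0 bi1 zr zi fz.
  have -> : M * b^-1 ^+ 2 / (1 - b^-1) ^+ 2 = M / (b - 1) ^+ 2.
    by field; rewrite !lt0r_neq0 //; lra.
  rewrite ler_pdivlMr ?exprn_gt0 //; last lra.
  have b1p : 0 < (b - 1) ^+ 2 by rewrite exprn_gt0 //; lra.
  nra.
have f_lt2 : `|f 0%N| < 2.
  apply: le_lt_trans ML; apply: le_trans (root_lead fM bi0 bi1 zr fz) _.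
  rewrite le_eqVlt; apply/orP; left; apply/eqP.
  by field; rewrite !lt0r_neq0 //; lra.
have [g [gS g0 gz]] : exists g, [/\ coefs S g, g 0%N = 1 & root_of g z].
  have [e|e] := int_small (S_int (fS 0%N)) f0 f_lt2; first by exists f.
  exists (fun i => - f i); split; [by move=> i; apply: SN | by rewrite e opprK | exact: rootN].
have zE : z = (complex.Re z)%:C by case: (z) zi => p q /= ->.
have : `|complex.Re z| = b^-1 by rewrite -zb [in RHS]zE normc_real.
have [p|p] := ger0P (complex.Re z) => e.
  by apply: (no_real_root b0 bM bn gS g0); rewrite -e -zE.
have alt_coefs : coefs S (fun i => (-1) ^+ i * g i).
  by move=> i; rewrite -signr_odd; case: (odd i); rewrite ?expr1 ?expr0 ?mulN1r ?mul1r ?SN.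
apply: (no_real_root b0 bM bn alt_coefs); first by rewrite expr0 mul1r.
have -> : (b^-1)%:C = - z by rewrite -e [in RHS]zE; exact: rmorphN.
exact: root_alternate.
Qed.

(** [1 - s z - s z^2 - ..] vanishes at [1 / (s + 1)]. *)
Lemma inverse_in_Sigma s : s \in S -> 1 <= s -> SigmaS ((s + 1)^-1)%:C.
Proof.
move=> sS s1; have n0 : 0 < (s + 1)^-1 by rewrite invr_gt0; lra.
apply/(SigmaP SM); rewrite normc_real ger0_norm ?ltW //; split.
  by rewrite invf_lt1; lra.
exists (fun i => if i is 0 then 1 else - s); split.
- by case=> [|i] //; apply: SN.
- exact: oner_neq0.
split; first by rewrite -normc_eq0 normc_real normr_eq0 gt_eqF.
exists 1; case=> [|n]; first by rewrite -[divlin _ _ _]/(1%:C) normc_real normr1.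
have -> : divlin (((s + 1)^-1)%:C)^-1 (cseq (fun i => if i is 0 then 1 else - s)) n.+1 = 1.
  elim: n.+1 => // m IH.
  rewrite [LHS]/= IH -fmorphV invrK /cseq rmorphN rmorphD.
  by rewrite rmorph1; ring.
by rewrite normc1.
Qed.

Lemma large_gap_not_connected : ~ connected SigmaS.
Proof.
have M4' := M4; have [rho /andP[r1 r2] miss] := Sigma_misses_circle.
have inM := inverse_in_Sigma MS (_ : 1 <= M).
have in2 := inverse_in_Sigma S_1 (lexx 1).
move=> cS'; pose B := SigmaS `&` cball 0 rho.
have BS : B = SigmaS.
  apply: cS'.
  - exists ((M + 1)^-1)%:C; split; first by apply: inM; lra.
    by rewrite /cball /mkset subr0 normc_real ger0_norm // invr_ge0; lra.
  - by exists (cball 0 rho) => //; exact: open_cball.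
  - exists [set z | normc z <= rho].
      apply/closed_normcP => z hz; apply/ler_addgt0Pr => e e0.
      have [x /= xr xz] := hz e e0; have := normcB_ge z x; rewrite normcBC; lra.
    apply/seteqP; split=> z [Sz zr]; split=> //.
      by move: zr; rewrite /cball /= subr0 => /ltW.
    by move: zr; rewrite /cball /mkset subr0 lt_neqAle miss.
move: in2; rewrite -BS => -[_]; rewrite /cball /mkset subr0 normc_real ger0_norm; last first.
  by rewrite invr_ge0; lra.
have -> : (1 + 1 : R) = 2 by [].
rewrite -div1r; lra.
Qed.

End LargeGap.

Theorem theorem5p1 (R : realType) (S : {fset R})
    (S_normalized : normalized S) (S_symmetric : symmetric_fset S)
    (S_int : forall s, s \in S -> s \is a Num.int) (S_0 : 0 \in S) :
  (3 <= total_gap S -> ~ connected (Sigma (set_of_reals S))) /\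
  (forall M : R, M \in S -> ubound [set` S] M ->
    total_gap S = 1 \/ total_gap S = 2 -> 40 <= M ->
    connected (Sigma (set_of_reals S)) /\
    locally_connected (Sigma (set_of_reals S))).
Proof.
have [S_neq0 S_1 _] := S_normalized.
have SN s : s \in S -> - s \in S.
  by move=> sS; rewrite S_symmetric; apply/imfsetP; exists s.
split=> [tg|M MS M_ub tg M40].
- have g0 : 0 < 3 :> R by lra.
  have [M MS M_max] := fset_max S_neq0.
  have [a [c [aS cS ac gap]]] := gap_of_total_gap g0 tg.
  have [a0|c0] := gap 0 S_0.
    apply: (@large_gap_not_connected R S M a c) => //.
    by have [//|] := gap 1 S_1; lra.
  apply: (@large_gap_not_connected R S M (- c) (- a)) => //.
  + by have [|] := gap (-1) (SN _ S_1); lra.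
  + lra.
  + exact: SN.
  + by move=> s /SN /gap [] ?; [right | left]; lra.
- have M_max s : s \in S -> s <= M by move=> sS; apply: M_ub.
  have tg2 : total_gap S <= 2 by case: tg => ->; lra.
  have SMr := gap_two_dense_digits S_int SN S_0 S_1 MS M_max tg2 M40.
  by split; [exact: (Sigma_connected SMr) | exact: (Sigma_locally_connected SMr)].
Qed.
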